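(* Let $n$ be an odd positive integer, let $(\mathcal{C},\mathbb{E},\mathfrak{s})$ be an $n$-exangulated category and let $\mathcal{S}$ be a dense and complete subcategory of $\mathcal{C}$. The following statements hold: 1. The subcategory $\mathcal{S}$ is extension-closed. 2. The triplet $(\mathcal{S},\mathbb{E}|_{\mathcal{S}^{\mathrm{op}}\times\mathcal{S}},\mathfrak{t})$ is an $n$-exangulated subcategory of $\mathcal{C}$, where $\mathfrak{t}$ is defined as follows: for objects $A,C$ in $\mathcal{S}$ and $\delta\in\mathbb{E}(C,A)$, choose a distinguished $n$-exangle $\langle X_\bullet,\delta\rangle$ of $\mathcal{C}$ with $X_i$ in $\mathcal{S}$ for $i=1,\dots,n$, and put $\mathfrak{t}(\delta)=[X_\bullet]$, the homotopy equivalence class being taken in $\mathbf{C}^{n+2}_{(\mathcal{S};A,C)}$.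
   Context: **$n$-exangulated categories.** Let $n\geq 1$ be an integer, $\mathcal{C}$ an additive category and $\mathbb{E}\colon \mathcal{C}^{\mathrm{op}}\times\mathcal{C}\to \mathrm{Ab}$ a biadditive functor to abelian groups. An element $\delta\in\mathbb{E}(C,A)$ is called an extension; the zero element is written ${}_A0_C$. For $a\colon A\to A'$ and $c\colon C'\to C$ write $a_*\delta=\mathbb{E}(C,a)(\delta)\in\mathbb{E}(C,A')$ and $c^*\delta=\mathbb{E}(c,A)(\delta)\in\mathbb{E}(C',A)$. A morphism of extensions $(a,c)\colon\delta\to\rho$, with $\delta\in\mathbb{E}(C,A)$, $\rho\in\mathbb{E}(D,B)$, is a pair $a\colon A\to B$, $c\colon C\to D$ with $a_*\delta=c^*\rho$. $\mathbf{C}^{n+2}_{\mathcal{C}}$ is the category of complexes $X_\bullet\colon X_0\xrightarrow{d_0}X_1\to\cdots\to X_n\xrightarrow{d_n}X_{n+1}$ in $\mathcal{C}$ concentrated in degrees $0,\dots,n+1$, with chain maps $f_\bullet=(f_0,\dots,f_{n+1})$. For objects $A,C$, $\mathbf{C}^{n+2}_{(\mathcal{C};A,C)}$ is its subcategory of complexes with $X_0=A$, $X_{n+1}=C$ and chain maps with $f_0=1_A$, $f_{n+1}=1_C$. Two such complexes $X_\bullet,Y_\bullet$ are homotopy equivalent if there are morphisms $f_\bullet\colon X_\bullet\to Y_\bullet$, $g_\bullet\colon Y_\bullet\to X_\bullet$ in $\mathbf{C}^{n+2}_{(\mathcal{C};A,C)}$ with $g_\bullet f_\bullet$ and $f_\bullet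 g_\bullet$ chain homotopic (in the usual sense) to identities; $[X_\bullet]$ denotes the resulting class in $\mathbf{C}^{n+2}_{(\mathcal{C};A,C)}$. The same notation is used with $\mathcal{C}$ replaced by another additive category. A pair $\langle X_\bullet,\delta\rangle$ with $\delta\in\mathbb{E}(X_{n+1},X_0)$ is an $n$-exangle if the sequences of functors $\mathcal{C}(-,X_0)\to\cdots\to\mathcal{C}(-,X_{n+1})\xrightarrow{\delta_\sharp}\mathbb{E}(-,X_0)$ and $\mathcal{C}(X_{n+1},-)\to\cdots\to\mathcal{C}(X_0,-)\xrightarrow{\delta^\sharp}\mathbb{E}(X_{n+1},-)$ are exact, where $\delta_\sharp(f)=f^*\delta$ and $\delta^\sharp(g)=g_*\delta$. An exact realization $\mathfrak{s}$ of $\mathbb{E}$ assigns to each $\delta\in\mathbb{E}(C,A)$ a class $\mathfrak{s}(\delta)=[X_\bullet]$ in $\mathbf{C}^{n+2}_{(\mathcal{C};A,C)}$ such that: (R0) for $\mathfrak{s}(\delta)=[X_\bullet]$, $\mathfrak{s}(\rho)=[Y_\bullet]$, every morphism of extensions $(a,c)\colon\delta\to\rho$ has a lift, i.e. a chain map $f_\bullet\colon X_\bullet\to Y_\bullet$ with $f_0=a$, $f_{n+1}=c$; (R1) if $\mathfrak{s}(\delta)=[X_\bullet]$ then $\langle X_\bullet,\delta\rangle$ is an $n$-exangle; (R2) for every object $A$, $\mathfrak{s}({}_A0_0)=[A\xrightarrow{1_A}A\to0\to\cdots\to0]$ and $\mathfrak{s}({}_00_A)=[0\to\cdots\to0\to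 A\xrightarrow{1_A}A]$. If $\mathfrak{s}(\delta)=[X_\bullet]$, then $\langle X_\bullet,\delta\rangle$ is called a distinguished $n$-exangle and $X_\bullet$ a conflation; $d_0$ of a conflation is called an inflation and $d_n$ of a conflation a deflation. An $n$-exangulated category is a triplet $(\mathcal{C},\mathbb{E},\mathfrak{s})$ with $\mathfrak{s}$ an exact realization of $\mathbb{E}$ such that: (EA1) inflations are closed under composition, and deflations are closed under composition. (EA2) For $\delta\in\mathbb{E}(D,A)$, $c\colon C\to D$ and distinguished $n$-exangles $\langle X_\bullet,c^*\delta\rangle$, $\langle Y_\bullet,\delta\rangle$, there is a lift $f_\bullet\colon X_\bullet\to Y_\bullet$ of $(1_A,c)$ such that $\langle M^f_\bullet,(d_0^X)_*\delta\rangle$ is a distinguished $n$-exangle, where the mapping cone $M^f_\bullet$ is $X_1\to X_2\oplus Y_1\to\cdots\to X_{n+1}\oplus Y_n\to Y_{n+1}$ with differentials $\begin{bmatrix}-d_1^X\\ f_1\end{bmatrix}$, $\begin{bmatrix}-d_{i+1}^X&0\\ f_{i+1}&d_i^Y\end{bmatrix}$ ($1\le i\le n-1$), $\begin{bmatrix}f_{n+1}&d_n^Y\end{bmatrix}$. (EA2)$^{\mathrm{op}}$ The dual of (EA2): for $\delta\in\mathbb{E}(C,A)$, $a\colon A\to B$ and distinguished $n$-exangles $\langle X_\bullet,\delta\rangle$, $\langle Y_\bullet,a_*\delta\rangle$, there is a lift $g_\bullet\colon X_\bullet\to Y_\bullet$ of $(a,1_C)$ such that $\langle N^g_\bullet,(d_n^Y)^*\delta\rangle$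 is a distinguished $n$-exangle, where the mapping cocone $N^g_\bullet$ is $X_0\to X_1\oplus Y_0\to\cdots\to X_n\oplus Y_{n-1}\to Y_n$ with differentials $\begin{bmatrix}d_0^X\\ g_0\end{bmatrix}$, $\begin{bmatrix}d_i^X&0\\ g_i&-d_{i-1}^Y\end{bmatrix}$ ($1\le i\le n-1$), $\begin{bmatrix}g_n&-d_{n-1}^Y\end{bmatrix}$. **Dense and complete.** A full subcategory $\mathcal{S}$ of $\mathcal{C}$ is dense if each object of $\mathcal{C}$ is a direct summand of an object of $\mathcal{S}$; it is complete if, given any conflation in $\mathcal{C}$ with $n+1$ of its $n+2$ objects in $\mathcal{S}$, the remaining object is also in $\mathcal{S}$. **Extension-closed.** A full additive subcategory $\mathcal{S}\subseteq\mathcal{C}$ which is closed under isomorphisms is extension-closed if for all objects $A,C$ in $\mathcal{S}$ and any $\delta\in\mathbb{E}(C,A)$ there is a distinguished $n$-exangle $\langle X_\bullet,\delta\rangle$ with $X_i$ in $\mathcal{S}$ for $i=1,\dots,n$. **$n$-exangulated functors and subcategories.** For $n$-exangulated categories $(\mathcal{C}_1,\mathbb{E}_1,\mathfrak{s}_1)$ and $(\mathcal{C}_2,\mathbb{E}_2,\mathfrak{s}_2)$, an additive functor $F\colon\mathcal{C}_1\to\mathcal{C}_2$ is an $n$-exangulated functor if there is a natural transformation $\eta\colon\mathbb{E}_1\to\mathbb{E}_2(F^{\mathrm{op}}-,F-)$ such that $\mathfrak{s}_1(\delta)=[X_\bullet]$ for $\delta\in\mathbb{E}_1(C,A)$ implies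 $\mathfrak{s}_2(\eta(\delta))=[FX_\bullet]$. The transformation $\eta$ is called an inclusion if each component $\mathbb{E}_1(C,A)\to\mathbb{E}_2(FC,FA)$ is an inclusion of abelian groups. An $n$-exangulated subcategory of $(\mathcal{C},\mathbb{E},\mathfrak{s})$ is a full isomorphism-closed subcategory $\mathcal{S}$ carrying an $n$-exangulated structure $(\mathcal{S},\mathbb{E}',\mathfrak{s}')$ for which the inclusion functor $\mathcal{S}\to\mathcal{C}$ is $n$-exangulated and the associated natural transformation is an inclusion. *)

(* Defs.v *)
From HB Require Import structures.
From mathcomp Require Import all_boot all_algebra.
From mathcomp Require Import boolp classical_sets.

Set Implicit Arguments.
Unset Strict Implicit.
Unset Printing Implicit Defensive.

Import GRing.Theory.
Local Open Scope ring_scope.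

(** * Preadditive and additive categories *)

Record preadd : Type := Preadd {
  obj :> Type;
  hom : obj -> obj -> zmodType;
  idm : forall A, hom A A;
  mcomp : forall A B D, hom B D -> hom A B -> hom A D;
  compA : forall A B D F (h : hom D F) (g : hom B D) (f : hom A B),
    mcomp h (mcomp g f) = mcomp (mcomp h g) f;
  comp1m : forall A B (f : hom A B), mcomp (idm B) f = f;
  compm1 : forall A B (f : hom A B), mcomp f (idm A) = f;
  compDl : forall A B D (g g' : hom B D) (f : hom A B),
    mcomp (g + g') f = mcomp g f + mcomp g' f;
  compDr : forall A B D (g : hom B D) (f f' : hom A B),
    mcomp g (f + f') = mcomp g f + mcomp g f' }.

Arguments hom {p} A B.
Arguments idm {p} A.
Notation "g \oC f" := (mcomp g f) (at level 40, left associativity).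

Lemma comp0m (C : preadd) (A B D : C) (f : hom A B) : (0 : hom B D) \oC f = 0.
Proof. by apply: (addIr ((0 : hom B D) \oC f)); rewrite -compDl !add0r. Qed.

Lemma compm0 (C : preadd) (A B D : C) (g : hom B D) : g \oC (0 : hom A B) = 0.
Proof. by apply: (addIr (g \oC (0 : hom A B))); rewrite -compDr !add0r. Qed.

Lemma compNl (C : preadd) (A B D : C) (g : hom B D) (f : hom A B) :
  (- g) \oC f = - (g \oC f).
Proof. by apply: (addIr (g \oC f)); rewrite -compDl !addNr comp0m. Qed.

Lemma compNr (C : preadd) (A B D : C) (g : hom B D) (f : hom A B) :
  g \oC (- f) = - (g \oC f).
Proof. by apply: (addIr (g \oC f)); rewrite -compDr !addNr compm0. Qed.

Definition is_iso (C : preadd) (A B : C) (f : hom A B) : Prop :=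
  exists g : hom B A, g \oC f = idm A /\ f \oC g = idm B.

Definition is_zero (C : preadd) (Z : C) : Prop :=
  forall A : C, (forall f : hom Z A, f = 0) /\ (forall f : hom A Z, f = 0).

Record biproduct (C : preadd) (A B : C) : Type := Biproduct {
  bob :> C;
  in1 : hom A bob;
  in2 : hom B bob;
  pr1 : hom bob A;
  pr2 : hom bob B;
  pr1_in1 : pr1 \oC in1 = idm A;
  pr2_in2 : pr2 \oC in2 = idm B;
  pr1_in2 : pr1 \oC in2 = 0;
  pr2_in1 : pr2 \oC in1 = 0;
  in_pr : in1 \oC pr1 + in2 \oC pr2 = idm bob }.

Arguments in1 {C A B} b.
Arguments in2 {C A B} b.
Arguments pr1 {C A B} b.
Arguments pr2 {C A B} b.

Definition is_additive (C : preadd) : Prop :=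
  (exists Z : C, is_zero Z) /\ (forall A B : C, inhabited (biproduct A B)).

Record functor (C D : preadd) : Type := Functor {
  fob :> C -> D;
  fhom : forall A B : C, hom A B -> hom (fob A) (fob B);
  fhom_id : forall A, fhom (idm A) = idm (fob A);
  fhom_comp : forall A B K (g : hom B K) (f : hom A B),
    fhom (g \oC f) = fhom g \oC fhom f;
  fhomD : forall A B, {morph @fhom A B : f g / f + g} }.

(** * Biadditive functors [C^op x C -> Ab] *)

(* [push a] is E(C, a), written a_*; [pull c] is E(c, A), written c^*. *)
Record biadd (C : preadd) : Type := Biadd {
  ext :> C -> C -> zmodType;
  push : forall K A A', hom A A' -> ext K A -> ext K A';
  pull : forall K' K A, hom K' K -> ext K A -> ext K' A;
  pushD : forall K A A' (a : hom A A'), {morph @push K A A' a : x y / x + y};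
  pullD : forall K' K A (c : hom K' K), {morph @pull K' K A c : x y / x + y};
  push_id : forall K A (x : ext K A), push (idm A) x = x;
  pull_id : forall K A (x : ext K A), pull (idm K) x = x;
  push_comp : forall K A A' A'' (a' : hom A' A'') (a : hom A A') (x : ext K A),
    push (a' \oC a) x = push a' (push a x);
  pull_comp : forall K'' K' K A (c : hom K' K) (c' : hom K'' K') (x : ext K A),
    pull (c \oC c') x = pull c' (pull c x);
  push_pull : forall K' K A A' (a : hom A A') (c : hom K' K) (x : ext K A),
    push a (pull c x) = pull c (push a x);
  push_addm : forall K A A' (a b : hom A A') (x : ext K A),
    push (a + b) x = push a x + push b x;
  pull_addm : forall K' K A (c e : hom K' K) (x : ext K A),
    pull (c + e) x = pull c x + pull e x }.

(** * Complexes with prescribed end terms *)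

(* The degrees 0, ..., n+1.  The extreme degrees 0 and n+1 are separate
   constructors, so that a complex from A to K has A and K definitionally
   as its end terms; [Mid j] is the degree j+1. *)
Inductive pos (n : nat) : Type := Src | Mid of 'I_n | Tgt.

Arguments Src {n}.
Arguments Mid {n} j.
Arguments Tgt {n}.

Definition deg n (p : pos n) : nat :=
  match p with Src => 0 | Mid j => j.+1 | Tgt => n.+1 end.

(* The position of degree [i], for [i <= n.+1] (and [Tgt] beyond). *)
Definition at_ n (i : nat) : pos n :=
  if i is k.+1 then (if insub k is Some j then Mid j else Tgt) else Src.

Lemma degK n : cancel (@deg n) (@at_ n).
Proof.
case=> [|j|] //=; first by rewrite valK.
by rewrite insubN // ltnn.
Qed.

HB.instance Definition _ (n : nat) := Equality.copy (pos n) (can_type (@degK n)).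

Definition nextp n (p : pos n) : pos n := at_ n (deg p).+1.
Definition prevp n (p : pos n) : pos n := at_ n (deg p).-1.

Lemma deg_at n i : (i <= n.+1)%N -> deg (at_ n i) = i.
Proof.
case: i => [|k] //=; rewrite ltnS => kn.
case: insubP => [j _ <- //|] /=; rewrite -leqNgt => nk.
by congr _.+1; apply/eqP; rewrite eqn_leq kn nk.
Qed.

Lemma deg_le n (p : pos n) : (deg p <= n.+1)%N.
Proof. by case: p => [|j|] //=; rewrite ltnS ltnW. Qed.

Lemma deg_inj n : injective (@deg n).
Proof. exact: can_inj (@degK n). Qed.

Lemma deg_succ n (p : pos n) : p != Tgt -> deg (nextp p) = (deg p).+1.
Proof.
move=> pT; apply: deg_at; case: p pT => [|j|]; rewrite ?eqxx // => _.
exact: ltn_ord.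
Qed.

Lemma deg_pred n (p : pos n) : deg (prevp p) = (deg p).-1.
Proof. by rewrite /prevp deg_at // (leq_trans (leq_pred _)) ?deg_le. Qed.

Lemma deg_gt0 n (p : pos n) : p != Src -> (0 < deg p)%N.
Proof. by case: p => [|j|]; rewrite ?eqxx. Qed.

Definition with_ends n (C : preadd) (A : C) (mid : 'I_n -> C) (K : C)
    (p : pos n) : C :=
  match p with Src => A | Mid j => mid j | Tgt => K end.

(* Objects of C^{n+2}_(C; A, K).  The differential of degree i is
   [dif X (at_ n i) (at_ n i.+1)]; all other [dif X p q] vanish. *)
Record cpx (n : nat) (C : preadd) (A K : C) : Type := Cpx {
  mid : 'I_n -> C;
  dif : forall p q, hom (with_ends A mid K p) (with_ends A mid K q);
  dif_shape : forall p q, deg q != (deg p).+1 -> dif p q = 0;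
  difK : forall p q r, dif q r \oC dif p q = 0 }.

Arguments dif {n C A K} c p q.

Definition cob n (C : preadd) (A K : C) (X : cpx n A K) (p : pos n) : C :=
  with_ends A (mid X) K p.
Coercion cob : cpx >-> Funclass.

Record chmap n (C : preadd) (A K A' K' : C) (X : cpx n A K) (Y : cpx n A' K')
    : Type := Chmap {
  cm :> forall p, hom (X p) (Y p);
  cm_comm : forall p q, cm q \oC dif X p q = dif Y p q \oC cm p }.

(* At [Src] (resp. [Tgt]) the term [prevp p = p] (resp. [nextp p = p])
   contributes 0, since [dif _ p p = 0]. *)
Definition homotopic n (C : preadd) (A K A' K' : C)
    (X : cpx n A K) (Y : cpx n A' K') (u v : forall p, hom (X p) (Y p)) : Prop :=
  exists h : forall p q, hom (X p) (Y q), forall p,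
    u p - v p = dif Y (prevp p) p \oC h p (prevp p)
                + h (nextp p) p \oC dif X p (nextp p).

Definition htpy_equiv n (C : preadd) (A K : C) (X Y : cpx n A K) : Prop :=
  exists (f : chmap X Y) (g : chmap Y X),
    [/\ f Src = idm A /\ f Tgt = idm K,
        g Src = idm A /\ g Tgt = idm K,
        homotopic (fun p => g p \oC f p) (fun p => idm (X p)) &
        homotopic (fun p => f p \oC g p) (fun p => idm (Y p))].

Definition hclass n (C : preadd) (A K : C) (X : cpx n A K) : set (cpx n A K) :=
  [set Y | htpy_equiv X Y].

(** * The complexes A = A -> 0 -> ... -> 0 and 0 -> ... -> 0 -> A = A *)

Definition triv_src_mid n (C : preadd) (A Z : C) (j : 'I_n) : C :=
  if nat_of_ord j == 0%N then A else Z.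

Definition triv_src_dif n (C : preadd) (A Z : C) (p q : pos n) :
    hom (with_ends A (triv_src_mid A Z) Z p) (with_ends A (triv_src_mid A Z) Z q) :=
  match p, q with
  | Src, Mid j =>
      if nat_of_ord j == 0%N as b return hom A (if b then A else Z)
      then idm A else 0
  | _, _ => 0
  end.

Lemma triv_src_shape n (C : preadd) (A Z : C) (p q : pos n) :
  deg q != (deg p).+1 -> triv_src_dif A Z p q = 0.
Proof.
case: p q => [|i|] [|j|] //=; rewrite eqSS /triv_src_mid.
by case: eqP.
Qed.

Lemma triv_srcK n (C : preadd) (A Z : C) (p q r : pos n) :
  triv_src_dif A Z q r \oC triv_src_dif A Z p q = 0.
Proof. by case: p q r => [|i|] [|j|] [|k|] /=; rewrite ?comp0m ?compm0. Qed.

Definition triv_src n (C : preadd) (A Z : C) : cpx n A Z :=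
  Cpx (@triv_src_shape n C A Z) (@triv_srcK n C A Z).

Definition triv_tgt_mid n (C : preadd) (Z A : C) (j : 'I_n) : C :=
  if j.+1 == n then A else Z.

Definition triv_tgt_dif n (C : preadd) (Z A : C) (p q : pos n) :
    hom (with_ends Z (triv_tgt_mid Z A) A p) (with_ends Z (triv_tgt_mid Z A) A q) :=
  match p, q with
  | Mid j, Tgt =>
      if j.+1 == n as b return hom (if b then A else Z) A then idm A else 0
  | _, _ => 0
  end.

Lemma triv_tgt_shape n (C : preadd) (Z A : C) (p q : pos n) :
  deg q != (deg p).+1 -> triv_tgt_dif Z A p q = 0.
Proof.
case: p q => [|i|] [|j|] //=; rewrite eqSS eq_sym /triv_tgt_mid.
by case: eqP.
Qed.

Lemma triv_tgtK n (C : preadd) (Z A : C) (p q r : pos n) :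
  triv_tgt_dif Z A q r \oC triv_tgt_dif Z A p q = 0.
Proof. by case: p q r => [|i|] [|j|] [|k|] /=; rewrite ?comp0m ?compm0. Qed.

Definition triv_tgt n (C : preadd) (Z A : C) : cpx n Z A :=
  Cpx (@triv_tgt_shape n C Z A) (@triv_tgtK n C Z A).

(** * Mapping cones and cocones *)

(* [f p] when [p = q], and 0 otherwise. *)
Definition diag n (C : preadd) (A K A' K' : C) (X : cpx n A K) (Y : cpx n A' K')
    (f : chmap X Y) (p q : pos n) : hom (X p) (Y q) :=
  match p =P q with
  | ReflectT e => ecast r (hom (X p) (Y r)) e (f p)
  | ReflectF _ => 0
  end.

Lemma diag_eq n (C : preadd) (A K A' K' : C) (X : cpx n A K) (Y : cpx n A' K')
  (f : chmap X Y) (p : pos n) : diag f p p = f p.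
Proof. by rewrite /diag; case: eqP => // e; rewrite eq_axiomK. Qed.

Lemma diag_neq n (C : preadd) (A K A' K' : C) (X : cpx n A K) (Y : cpx n A' K')
  (f : chmap X Y) (p q : pos n) : p != q -> diag f p q = 0.
Proof. by rewrite /diag; case: eqP. Qed.

Section Cone.
Context {n : nat} {C : preadd} {A K A' K' : C}.
Context {X : cpx n A K} {Y : cpx n A' K'} (f : chmap X Y).

Section MappingCone.
Context (b : forall j : 'I_n, biproduct (X (nextp (Mid j))) (Y (Mid j))).

Definition cone_ob : pos n -> C := with_ends (X (at_ n 1)) b K'.

(* The injections and projections of the two summands X_{i+1} and Y_i of the
   i-th term of the cone, where Y_0 and X_{n+2} are left out. *)
Definition cone_inX (p : pos n) : hom (X (nextp p)) (cone_ob p) :=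
  match p with Src => idm _ | Mid j => in1 (b j) | Tgt => 0 end.
Definition cone_prX (p : pos n) : hom (cone_ob p) (X (nextp p)) :=
  match p with Src => idm _ | Mid j => pr1 (b j) | Tgt => 0 end.
Definition cone_inY (p : pos n) : hom (Y p) (cone_ob p) :=
  match p with Src => 0 | Mid j => in2 (b j) | Tgt => idm _ end.
Definition cone_prY (p : pos n) : hom (cone_ob p) (Y p) :=
  match p with Src => 0 | Mid j => pr2 (b j) | Tgt => idm _ end.

Definition cone_dif (p q : pos n) : hom (cone_ob p) (cone_ob q) :=
  cone_inX q \oC (- dif X (nextp p) (nextp q)) \oC cone_prX p
  + cone_inY q \oC diag f (nextp p) q \oC cone_prX p
  + cone_inY q \oC dif Y p q \oC cone_prY p.

Lemma cone_prX_inX (p : pos n) :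
  p != Tgt -> cone_prX p \oC cone_inX p = idm _.
Proof. by case: p => [|j|]; rewrite ?eqxx //= ?compm1 // pr1_in1. Qed.

Lemma cone_prY_inY (p : pos n) :
  p != Src -> cone_prY p \oC cone_inY p = idm _.
Proof. by case: p => [|j|]; rewrite ?eqxx //= ?compm1 // pr2_in2. Qed.

Lemma cone_prX_inY (p : pos n) : cone_prX p \oC cone_inY p = 0.
Proof. by case: p => [|j|] /=; rewrite ?compm0 ?comp0m // pr1_in2. Qed.

Lemma cone_prY_inX (p : pos n) : cone_prY p \oC cone_inX p = 0.
Proof. by case: p => [|j|] /=; rewrite ?compm0 ?comp0m // pr2_in1. Qed.

Lemma cone_shape (p q : pos n) : deg q != (deg p).+1 -> cone_dif p q = 0.
Proof.
move=> pq; rewrite /cone_dif (dif_shape Y pq) compm0 comp0m addr0.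
have [->|pT] := eqVneq p Tgt; first by rewrite !compm0 addr0.
rewrite (@diag_neq _ _ _ _ _ _ _ _ f); last first.
  by apply: contraNneq pq => <-; rewrite deg_succ.
rewrite compm0 comp0m addr0.
have [->|qT] := eqVneq q Tgt; first by rewrite !comp0m.
by rewrite dif_shape ?oppr0 ?compm0 ?comp0m // !deg_succ // eqSS.
Qed.

Lemma cone_difK (p q r : pos n) : cone_dif q r \oC cone_dif p q = 0.
Proof.
rewrite /cone_dif.
rewrite !(compDl, compDr) !(compNl, compNr) -!compA.
rewrite !(compA (cone_prX q)) !(compA (cone_prY q)) cone_prX_inY cone_prY_inX.
rewrite !(comp0m, compm0, oppr0, addr0, add0r).
have [->|qT] := eqVneq q Tgt.
  rewrite /= !(comp0m, compm0, oppr0, opprK, addr0, add0r).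
  by rewrite (dif_shape Y) ?comp0m ?compm0 ?addr0 //= neq_ltn ltnS deg_le.
rewrite cone_prX_inX // !comp1m.
rewrite [dif X (nextp q) _ \oC _]compA difK comp0m compm0 opprK add0r.
have [->|qS] := eqVneq q Src.
  rewrite /= !(comp0m, compm0, addr0).
  have [->|pT] := eqVneq p Tgt; first by rewrite /= !compm0 oppr0.
  rewrite (dif_shape X) ?comp0m ?compm0 ?oppr0 // !deg_succ //=.
rewrite cone_prY_inY // !comp1m.
rewrite [dif Y q r \oC (dif Y p q \oC _)]compA difK comp0m compm0 addr0.
have [->|pT] := eqVneq p Tgt; first by rewrite /= !compm0 oppr0 addr0.
rewrite -compNr -compDr (compA (diag _ _ _)) (compA (dif Y _ _)) -compNl -compDl.
suff -> : - (diag f (nextp q) r \oC dif X (nextp p) (nextp q))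
          + dif Y q r \oC diag f (nextp p) q = 0 by rewrite comp0m compm0.
have [pq|pq] := eqVneq (nextp p) q.
  rewrite pq diag_eq; have [<-|qr] := eqVneq (nextp q) r.
    by rewrite diag_eq cm_comm addNr.
  rewrite diag_neq // comp0m oppr0 add0r (dif_shape Y) ?comp0m //.
  by apply: contraNneq qr => e; apply/eqP/deg_inj; rewrite deg_succ.
rewrite (diag_neq _ pq) compm0 addr0 (dif_shape X) ?compm0 ?oppr0 //.
rewrite !deg_succ // eqSS; apply: contraNneq pq => e.
by apply/eqP/deg_inj; rewrite deg_succ.
Qed.

Definition cone : cpx n (X (at_ n 1)) K' := Cpx cone_shape cone_difK.
End MappingCone.

Section MappingCocone.
Context (b : forall j : 'I_n, biproduct (X (Mid j)) (Y (prevp (Mid j)))).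

Definition cocone_ob : pos n -> C := with_ends A b (Y (at_ n n)).

(* The summands X_i and Y_{i-1}, where Y_{-1} and X_{n+1} are left out. *)
Definition cocone_inX (p : pos n) : hom (X p) (cocone_ob p) :=
  match p with Src => idm _ | Mid j => in1 (b j) | Tgt => 0 end.
Definition cocone_prX (p : pos n) : hom (cocone_ob p) (X p) :=
  match p with Src => idm _ | Mid j => pr1 (b j) | Tgt => 0 end.
Definition cocone_inY (p : pos n) : hom (Y (prevp p)) (cocone_ob p) :=
  match p with Src => 0 | Mid j => in2 (b j) | Tgt => idm _ end.
Definition cocone_prY (p : pos n) : hom (cocone_ob p) (Y (prevp p)) :=
  match p with Src => 0 | Mid j => pr2 (b j) | Tgt => idm _ end.

Definition cocone_dif (p q : pos n) : hom (cocone_ob p) (cocone_ob q) :=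
  cocone_inX q \oC dif X p q \oC cocone_prX p
  + cocone_inY q \oC diag f p (prevp q) \oC cocone_prX p
  + cocone_inY q \oC (- dif Y (prevp p) (prevp q)) \oC cocone_prY p.

Lemma cocone_prX_inX (p : pos n) :
  p != Tgt -> cocone_prX p \oC cocone_inX p = idm _.
Proof. by case: p => [|j|]; rewrite ?eqxx //= ?compm1 // pr1_in1. Qed.

Lemma cocone_prY_inY (p : pos n) :
  p != Src -> cocone_prY p \oC cocone_inY p = idm _.
Proof. by case: p => [|j|]; rewrite ?eqxx //= ?compm1 // pr2_in2. Qed.

Lemma cocone_prX_inY (p : pos n) : cocone_prX p \oC cocone_inY p = 0.
Proof. by case: p => [|j|] /=; rewrite ?compm0 ?comp0m // pr1_in2. Qed.

Lemma cocone_prY_inX (p : pos n) : cocone_prY p \oC cocone_inX p = 0.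
Proof. by case: p => [|j|] /=; rewrite ?compm0 ?comp0m // pr2_in1. Qed.

Lemma cocone_shape (p q : pos n) : deg q != (deg p).+1 -> cocone_dif p q = 0.
Proof.
move=> pq; rewrite /cocone_dif (dif_shape X pq) compm0 comp0m add0r.
have [->|qS] := eqVneq q Src; first by rewrite /= !comp0m addr0.
rewrite diag_neq ?compm0 ?comp0m ?add0r; last first.
  by apply: contraNneq pq => ->; rewrite deg_pred prednK ?deg_gt0.
have [->|pS] := eqVneq p Src; first by rewrite !compm0.
rewrite dif_shape ?oppr0 ?compm0 ?comp0m // !deg_pred prednK ?deg_gt0 //.
by apply: contraNneq pq => <-; rewrite prednK ?deg_gt0.
Qed.

Lemma cocone_difK (p q r : pos n) : cocone_dif q r \oC cocone_dif p q = 0.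
Proof.
rewrite /cocone_dif.
rewrite !(compDl, compDr) !(compNl, compNr) -!compA.
rewrite !(compA (cocone_prX q)) !(compA (cocone_prY q)).
rewrite cocone_prX_inY cocone_prY_inX.
rewrite !(comp0m, compm0, oppr0, addr0, add0r).
have [->|qS] := eqVneq q Src.
  rewrite /= !(comp0m, compm0, oppr0, opprK, addr0, add0r).
  by rewrite (@dif_shape _ _ _ _ X p Src) // !(comp0m, compm0) addr0.
rewrite cocone_prY_inY // !comp1m.
rewrite [dif Y (prevp q) _ \oC (dif Y _ _ \oC _)]compA difK comp0m compm0.
rewrite opprK addr0.
have [->|qT] := eqVneq q Tgt.
  rewrite /= !(comp0m, compm0, addr0, add0r).
  have [->|rS] := eqVneq r Src; first by rewrite /= !comp0m oppr0.
  rewrite (dif_shape Y) ?comp0m ?compm0 ?oppr0 // !deg_pred /=.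
  by rewrite neq_ltn ltnS -subn1 leq_subLR add1n deg_le.
rewrite cocone_prX_inX // !comp1m.
rewrite [dif X q r \oC _]compA difK comp0m compm0 add0r.
have [->|rS] := eqVneq r Src; first by rewrite /= !comp0m subr0.
rewrite -compNr -compDr (compA (diag _ _ _)) (compA (dif Y _ _)) -compNl -compDl.
suff -> : diag f q (prevp r) \oC dif X p q
          - dif Y (prevp q) (prevp r) \oC diag f p (prevp q) = 0.
  by rewrite comp0m compm0.
have [pq|pq] := eqVneq p (prevp q); last first.
  rewrite (diag_neq _ pq) compm0 subr0 (dif_shape X) ?compm0 //.
  by apply: contraNneq pq => e; apply/eqP/deg_inj; rewrite deg_pred e.
rewrite pq diag_eq; have [<-|qr] := eqVneq q (prevp r).
  by rewrite diag_eq cm_comm subrr.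
rewrite diag_neq // comp0m sub0r (dif_shape Y) ?comp0m ?oppr0 //.
apply: contraNneq qr => e; apply/eqP/deg_inj.
by rewrite e [in RHS]deg_pred prednK ?deg_gt0.
Qed.

Definition cocone : cpx n A (Y (at_ n n)) := Cpx cocone_shape cocone_difK.
End MappingCocone.
End Cone.

(** * n-exangles, exact realizations, n-exangulated categories *)

Definition exact_pair (U V W : zmodType) (u : U -> V) (v : V -> W) : Prop :=
  forall y, v y = 0 <-> exists x, u x = y.

Definition is_exangle n (C : preadd) (E : biadd C) (A K : C)
    (X : cpx n A K) (x : E K A) : Prop :=
  forall W : C,
    [/\ forall j : 'I_n,
          exact_pair (fun g : hom W (X (prevp (Mid j))) => dif X (prevp (Mid j)) (Mid j) \oC g)
                (fun g : hom W (X (Mid j)) => dif X (Mid j) (nextp (Mid j)) \oC g),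
        exact_pair (fun g : hom W (X (at_ n n)) => dif X (at_ n n) Tgt \oC g)
              (fun g : hom W K => pull g x),
        forall j : 'I_n,
          exact_pair (fun g : hom (X (nextp (Mid j))) W => g \oC dif X (Mid j) (nextp (Mid j)))
                (fun g : hom (X (Mid j)) W => g \oC dif X (prevp (Mid j)) (Mid j)) &
        exact_pair (fun g : hom (X (at_ n 1)) W => g \oC dif X Src (at_ n 1))
              (fun g : hom A W => push g x)].

Definition realization (n : nat) (C : preadd) (E : biadd C) : Type :=
  forall K A : C, E K A -> set (cpx n A K).

Record exact_realization n (C : preadd) (E : biadd C) (s : realization n E)
    : Prop := ExactRealization {
  real_class : forall (A K : C) (x : E K A), exists X, s K A x = hclass X;
  real_lift : forall (A K B D : C) (x : E K A) (y : E D B)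
      (X : cpx n A K) (Y : cpx n B D) (a : hom A B) (c : hom K D),
    s _ _ x = hclass X -> s _ _ y = hclass Y -> push a x = pull c y ->
    exists f : chmap X Y, f Src = a /\ f Tgt = c;
  real_exangle : forall (A K : C) (x : E K A) (X : cpx n A K),
    s _ _ x = hclass X -> is_exangle X x;
  real_triv : forall A Z : C, is_zero Z ->
    s Z A 0 = hclass (triv_src n A Z) /\ s A Z 0 = hclass (triv_tgt n Z A) }.

Definition conflation n (C : preadd) (E : biadd C) (s : realization n E)
    (A K : C) (X : cpx n A K) : Prop :=
  exists x : E K A, s K A x = hclass X.

Inductive inflation n (C : preadd) (E : biadd C) (s : realization n E) :
    forall A B : C, hom A B -> Prop :=
  Inflation (A K : C) (X : cpx n A K) of conflation s X :
    inflation s (dif X Src (at_ n 1)).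

Inductive deflation n (C : preadd) (E : biadd C) (s : realization n E) :
    forall A B : C, hom A B -> Prop :=
  Deflation (A K : C) (X : cpx n A K) of conflation s X :
    deflation s (dif X (at_ n n) Tgt).

(* In (EA2) and its dual the direct sums in the (co)cone are taken with respect
   to some choice of biproducts; all choices give isomorphic complexes. *)
Record nexangulated n (C : preadd) (E : biadd C) (s : realization n E)
    : Prop := Nexangulated {
  nex_gt0 : (0 < n)%N;
  nex_additive : is_additive C;
  nex_real : exact_realization s;
  nex_EA1 : forall (A B D : C) (u : hom A B) (v : hom B D),
    inflation s u -> inflation s v -> inflation s (v \oC u);
  nex_EA1op : forall (A B D : C) (u : hom A B) (v : hom B D),
    deflation s u -> deflation s v -> deflation s (v \oC u);
  nex_EA2 : forall (A K D : C) (x : E D A) (c : hom K D)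
      (X : cpx n A K) (Y : cpx n A D),
    s _ _ (pull c x) = hclass X -> s _ _ x = hclass Y ->
    exists f : chmap X Y, [/\ f Src = idm A, f Tgt = c &
      exists b, s _ _ (push (dif X Src (at_ n 1)) x) = hclass (cone f b)];
  nex_EA2op : forall (A B K : C) (x : E K A) (a : hom A B)
      (X : cpx n A K) (Y : cpx n B K),
    s _ _ x = hclass X -> s _ _ (push a x) = hclass Y ->
    exists g : chmap X Y, [/\ g Src = a, g Tgt = idm K &
      exists b, s _ _ (pull (dif Y (at_ n n) Tgt) x) = hclass (cocone g b)] }.

(** * n-exangulated functors *)

Section MapComplex.
Context {n : nat} {C D : preadd} (F : functor C D) {A K : C} (X : cpx n A K).

Definition map_mid (j : 'I_n) : D := F (mid X j).

Definition map_hom (p q : pos n) : hom (X p) (X q) ->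
    hom (with_ends (F A) map_mid (F K) p) (with_ends (F A) map_mid (F K) q) :=
  match p, q with
  | Src, Src => fun u => fhom F u
  | Src, Mid _ => fun u => fhom F u
  | Src, Tgt => fun u => fhom F u
  | Mid _, Src => fun u => fhom F u
  | Mid _, Mid _ => fun u => fhom F u
  | Mid _, Tgt => fun u => fhom F u
  | Tgt, Src => fun u => fhom F u
  | Tgt, Mid _ => fun u => fhom F u
  | Tgt, Tgt => fun u => fhom F u
  end.

Lemma fhom0 (B B' : C) : fhom F (0 : hom B B') = 0.
Proof. by apply: (addIr (fhom F (0 : hom B B'))); rewrite -fhomD !add0r. Qed.

Lemma map_shape (p q : pos n) :
  deg q != (deg p).+1 -> map_hom (dif X p q) = 0.
Proof.
by move=> /(dif_shape X) ->; case: p q => [|i|] [|j|] /=; rewrite fhom0.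
Qed.

Lemma map_difK (p q r : pos n) :
  map_hom (dif X q r) \oC map_hom (dif X p q) = 0.
Proof.
move: (dif X q r) (dif X p q) (difK X p q r).
by case: p q r => [|i|] [|j|] [|k|] u v /= uv0; rewrite -fhom_comp uv0 fhom0.
Qed.

Definition map_cpx : cpx n (F A) (F K) := Cpx map_shape map_difK.
End MapComplex.

Record is_nat_trans (C D : preadd) (F : functor C D) (E1 : biadd C) (E2 : biadd D)
    (eta : forall K A : C, E1 K A -> E2 (F K) (F A)) : Prop := IsNatTrans {
  nat_add : forall K A, {morph @eta K A : x y / x + y};
  nat_push : forall K A A' (a : hom A A') (x : E1 K A),
    eta _ _ (push a x) = push (fhom F a) (eta _ _ x);
  nat_pull : forall K' K A (c : hom K' K) (x : E1 K A),
    eta _ _ (pull c x) = pull (fhom F c) (eta _ _ x) }.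

(* [F] is n-exangulated, with associated natural transformation [eta]. *)
Definition nexangulated_via n (C D : preadd) (F : functor C D)
    (E1 : biadd C) (s1 : realization n E1) (E2 : biadd D) (s2 : realization n E2)
    (eta : forall K A : C, E1 K A -> E2 (F K) (F A)) : Prop :=
  is_nat_trans eta /\
  forall (A K : C) (x : E1 K A) (X : cpx n A K),
    s1 K A x = hclass X -> s2 _ _ (eta K A x) = hclass (map_cpx F X).

(** * Full subcategories, given by sets of objects *)

Definition full_sub (C : preadd) (S : set C) : preadd :=
  @Preadd {A : C | S A} (fun A B => hom (sval A) (sval B))
    (fun A => idm (sval A)) (fun A B D g f => g \oC f)
    (fun A B D F h g f => compA h g f)
    (fun A B f => comp1m f) (fun A B f => compm1 f)
    (fun A B D g g' f => compDl g g' f) (fun A B D g f f' => compDr g f f').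

Definition incl (C : preadd) (S : set C) : functor (full_sub S) C :=
  @Functor (full_sub S) C (fun A => sval A) (fun A B f => f)
    (fun A => erefl) (fun A B K g f => erefl) (fun A B f g => erefl).

Definition restr (C : preadd) (S : set C) (E : biadd C) : biadd (full_sub S) :=
  @Biadd (full_sub S) (fun K A => E (sval K) (sval A))
    (fun K A A' => @push C E (sval K) (sval A) (sval A'))
    (fun K' K A => @pull C E (sval K') (sval K) (sval A))
    (fun K A A' => @pushD C E (sval K) (sval A) (sval A'))
    (fun K' K A => @pullD C E (sval K') (sval K) (sval A))
    (fun K A => @push_id C E (sval K) (sval A))
    (fun K A => @pull_id C E (sval K) (sval A))
    (fun K A A' A'' => @push_comp C E (sval K) (sval A) (sval A') (sval A''))
    (fun K'' K' K A => @pull_comp C E (sval K'') (sval K') (sval K) (sval A))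
    (fun K' K A A' => @push_pull C E (sval K') (sval K) (sval A) (sval A'))
    (fun K A A' => @push_addm C E (sval K) (sval A) (sval A'))
    (fun K' K A => @pull_addm C E (sval K') (sval K) (sval A)).

Definition iso_closed (C : preadd) (S : set C) : Prop :=
  forall (A B : C) (f : hom A B), is_iso f -> S A -> S B.

Definition dense (C : preadd) (S : set C) : Prop :=
  forall A : C, exists (A' : C) (b : biproduct A A'), S b.

Definition complete n (C : preadd) (E : biadd C) (s : realization n E)
    (S : set C) : Prop :=
  forall (A K : C) (X : cpx n A K), conflation s X ->
  forall p : pos n, (forall q, q != p -> S (X q)) -> S (X p).

Definition extension_closed n (C : preadd) (E : biadd C) (s : realization n E)
    (S : set C) : Prop :=
  [/\ is_additive (full_sub S), iso_closed S &
      forall (A K : C) (x : E K A), S A -> S K ->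
      exists X : cpx n A K, s K A x = hclass X /\ forall j, S (mid X j)].

Definition nexangulated_subcategory n (C : preadd) (E : biadd C)
    (s : realization n E) (S : set C)
    (E' : biadd (full_sub S)) (t : realization n E') : Prop :=
  [/\ iso_closed S, nexangulated t &
      exists eta : forall K A : full_sub S, E' K A -> E (incl S K) (incl S A),
        nexangulated_via t s eta /\ forall K A, injective (eta K A)].

(* [t] arises from a choice, for every extension between objects of [S], of a
   distinguished n-exangle of [C] with all terms in [S], that is, of a complex
   in [full_sub S] whose image in [C] realizes the extension. *)
Definition induced_realization n (C : preadd) (E : biadd C)
    (s : realization n E) (S : set C) (t : realization n (restr S E)) : Prop :=
  forall (A K : full_sub S) (x : restr S E K A),
  exists X : cpx n A K,
    s (sval K) (sval A) x = hclass (map_cpx (incl S) X) /\ t K A x = hclass X.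

(* Main.v *)
From mathcomp Require Import all_boot all_algebra.
From mathcomp Require Import boolp classical_sets.
Require Import Defs.

(** Throughout, an extension is handled through complexes known only up to
    homotopy equivalence, so the proof rests on a criterion for a given complex
    [X] to realize a given extension [x].  If [Z] realizes [x], it is enough
    that [hom(-, W)] is exact at the middle terms of [X] and that there are
    chain maps between [X] and [Z], in both directions, with identity end terms
    ([recognize]).  The point is that an endomorphism [u] of such a complex that
    vanishes on both end terms satisfies [u^2 ~ 0] ([square_homotopic0]), so
    that for [f : X -> Z] and [g : Z -> X] the chain map [2g - gfg] is inverse
    to [f] up to homotopy.  Since morphisms of extensions lift to chain maps,
    the criterion gives that realizations are stable under isomorphism
    ([real_iso]) and under direct sums ([dsum_real]), and that every
    contractible complex realizes zero ([real_contractible]).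

    For a sequence of objects [T_0, T_1, ...] with [T_{n+1} = 0] consider the
    contractible complex
      [T_0 -> T_1 + T_0 -> T_2 + T_1 -> ... -> T_n + T_{n-1} -> T_n]
    ([elem]).  It is a conflation, and it is used in two ways.

    First, completeness of [S] applied to it gives the closure properties of
    [S].  Taking [T = (A, 0, A, 0, ...)] with [A] in [S], all terms are [A]
    except the last one, which is [0] because [n] is odd; hence [S] contains
    the zero objects.  Taking [T = (A, B, 0, 0, ...)], all terms but a
    biproduct of [A] and [B] lie in [S]; hence [S] is closed under biproducts,
    and under isomorphisms.

    Secondly, it is added to a conflation [X] in order to move its terms into
    [S] ([padding]).  By density one can choose the [T_k] one after the other
    such that [X_k + T_{k-1} + T_k] lies in [S] for all [k] but one, and
    completeness takes care of the last one.  Choosing [T_0 = T_n = 0] leaves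
    the end terms of [X] unchanged: this is extension-closedness.  Choosing
    [T_0 = T_1 = 0] (resp. [T_{n-1} = T_n = 0]) leaves the differential [d_0]
    (resp. [d_n]) unchanged: an inflation (resp. deflation) of the ambient
    category between objects of [S] is the first (resp. last) differential of
    a conflation with all terms in [S], whence (EA1) and its dual.

    The other axioms for the induced realization [t] follow from those of the
    ambient category because [t] is characterized by: [X] realizes [x] in [S]
    if and only if its image realizes [x] in the ambient category
    ([induced_iff]). *)

Set Implicit Arguments.
Unset Strict Implicit.
Unset Printing Implicit Defensive.

Import GRing.Theory.
Local Open Scope ring_scope.

(** * Positions *)

Section Positions.
Context {n : nat}.
Implicit Types p q : pos n.

Lemma nextpK p : p != Tgt -> prevp (nextp p) = p.
Proof. by move=> pT; apply: deg_inj; rewrite deg_pred deg_succ. Qed.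

Lemma prevp_neqT p : prevp p != Tgt.
Proof.
apply/eqP => /(congr1 (@deg n)); rewrite deg_pred /= => e.
by have := deg_le p; case: (deg p) e => //= m ->; rewrite ltnn.
Qed.

Lemma prevpK p : p != Src -> nextp (prevp p) = p.
Proof.
move=> pS; apply: deg_inj.
by rewrite deg_succ ?prevp_neqT // deg_pred prednK // deg_gt0.
Qed.

Lemma nextp_neqS p : nextp p != Src.
Proof. by case: p => [|j|]; rewrite /nextp /=; case: insub. Qed.

Lemma mid_neqT (j : 'I_n) : Mid j != Tgt.
Proof. by apply/eqP. Qed.

Lemma deg_next p q : deg q = (deg p).+1 -> p != Tgt /\ q = nextp p.
Proof.
move=> e; have pT : p != Tgt.
  by apply: contra_eq_neq e => -> /=; rewrite neq_ltn ltnS deg_le.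
by split=> //; apply: deg_inj; rewrite deg_succ.
Qed.

Lemma posP p q : p != Tgt /\ q = nextp p \/ deg q != (deg p).+1.
Proof. by case: (deg q =P _) => [/deg_next|]; [left|right]. Qed.

End Positions.

Lemma atn_neqS n : (0 < n)%N -> at_ n n != Src.
Proof.
move=> n0; apply/eqP => /(congr1 (@deg n)); rewrite deg_at //= => e.
by rewrite e in n0.
Qed.

Section Differentials.
Context {n : nat} {C : preadd} {A K : C} (X : cpx n A K).

Lemma dif_Tgt q : dif X Tgt q = 0.
Proof. by rewrite dif_shape //= neq_ltn ltnS deg_le. Qed.

Lemma dif_Src p : dif X p Src = 0.
Proof. by rewrite dif_shape. Qed.

End Differentials.

(** * Chain maps *)

Section ChainMaps.
Context {n : nat} {C : preadd}.

(** All components of the differential that raise the degree by something else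
    than one vanish, so only the squares between consecutive degrees matter. *)
Lemma comm_next (A K A' K' : C) (X : cpx n A K) (Y : cpx n A' K')
    (f : forall p, hom (X p) (Y p)) :
  (forall p, p != Tgt ->
    f (nextp p) \oC dif X p (nextp p) = dif Y p (nextp p) \oC f p) ->
  forall p q, f q \oC dif X p q = dif Y p q \oC f p.
Proof.
move=> H p q; have [[pT ->]|pq] := posP p q; first exact: H.
by rewrite !dif_shape // comp0m compm0.
Qed.

Definition chid (A K : C) (X : cpx n A K) : chmap X X.
Proof. by exists (fun p => idm (X p)) => p q; rewrite comp1m compm1. Defined.

Definition chcomp (A K A' K' A'' K'' : C) (X : cpx n A K) (Y : cpx n A' K')
  (Z : cpx n A'' K'') (g : chmap Y Z) (f : chmap X Y) : chmap X Z.
Proof.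
exists (fun p => g p \oC f p) => p q.
by rewrite -compA cm_comm !compA cm_comm.
Defined.

Definition chadd (A K A' K' : C) (X : cpx n A K) (Y : cpx n A' K')
  (f g : chmap X Y) : chmap X Y.
Proof. by exists (fun p => f p + g p) => p q; rewrite compDl compDr !cm_comm. Defined.

Definition chopp (A K A' K' : C) (X : cpx n A K) (Y : cpx n A' K')
  (f : chmap X Y) : chmap X Y.
Proof. by exists (fun p => - f p) => p q; rewrite compNl compNr cm_comm. Defined.

Definition fix_ends (A K : C) (X Y : cpx n A K) (f : chmap X Y) : Prop :=
  f Src = idm A /\ f Tgt = idm K.

Lemma fix_comp (A K : C) (X Y Z : cpx n A K) (g : chmap Y Z) (f : chmap X Y) :
  fix_ends g -> fix_ends f -> fix_ends (chcomp g f).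
Proof. by move=> [g0 g1] [f0 f1]; split; rewrite /= ?g0 ?f0 ?g1 ?f1 comp1m. Qed.

End ChainMaps.

(** * Homotopies *)

Section Homotopies.
Context {n : nat} {C : preadd}.

Lemma homotopic_of_diff (A K A' K' : C) (X : cpx n A K) (Y : cpx n A' K')
    (u v w : forall p, hom (X p) (Y p)) :
  homotopic w (fun p => 0) -> (forall p, v p - u p = w p) -> homotopic u v.
Proof.
case=> h Hh e; exists (fun p q => - h p q) => p.
by rewrite -opprB e -[w p]subr0 Hh compNl compNr opprD.
Qed.

Lemma homotopic_trans (A K A' K' : C) (X : cpx n A K) (Y : cpx n A' K')
    (u v w : forall p, hom (X p) (Y p)) :
  homotopic u v -> homotopic v w -> homotopic u w.
Proof.
move=> [h Hh] [k Hk]; exists (fun p q => h p q + k p q) => p.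
rewrite -[u p](subrK (v p)) -addrA Hh Hk compDl compDr.
by rewrite addrACA.
Qed.

Lemma homotopic_whisker (A K A' K' A1 K1 A1' K1' : C) (X : cpx n A K)
    (Y : cpx n A' K') (X1 : cpx n A1 K1) (Y1 : cpx n A1' K1')
    (g : chmap Y Y1) (f : chmap X1 X) (u v : forall p, hom (X p) (Y p)) :
  homotopic u v ->
  homotopic (fun p => g p \oC u p \oC f p) (fun p => g p \oC v p \oC f p).
Proof.
case=> h Hh; exists (fun p q => g q \oC h p q \oC f p) => p.
rewrite -compNl -compDl -compNr -compDr Hh compDr compDl.
by rewrite !compA cm_comm -!compA -cm_comm !compA.
Qed.

Definition contractible (A K : C) (X : cpx n A K) : Prop :=
  homotopic (fun p => idm (X p)) (fun p => 0).

Lemma htpy_refl (A K : C) (X : cpx n A K) : htpy_equiv X X.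
Proof.
exists (chid X), (chid X); split=> //; exists (fun p q => 0) => p /=;
  by rewrite comp1m subrr compm0 comp0m addr0.
Qed.

Lemma htpy_sym (A K : C) (X Y : cpx n A K) : htpy_equiv X Y -> htpy_equiv Y X.
Proof. by case=> f [g [H1 H2 H3 H4]]; exists g, f; split. Qed.

Lemma htpy_trans (A K : C) (X Y Z : cpx n A K) :
  htpy_equiv X Y -> htpy_equiv Y Z -> htpy_equiv X Z.
Proof.
case=> f [g [f1 g1 gf fg]] [f' [g' [f1' g1' gf' fg']]].
exists (chcomp f' f), (chcomp g g'); split; [exact: fix_comp|exact: fix_comp| |].
- apply: homotopic_trans gf; have := homotopic_whisker g f gf'.
  by case=> h Hh; exists h => p; rewrite -Hh /= compm1 !compA.
- apply: homotopic_trans fg'; have := homotopic_whisker f' g' fg.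
  by case=> h Hh; exists h => p; rewrite -Hh /= compm1 !compA.
Qed.

(** Statements about classes of complexes become statements about homotopy
    equivalences: homotopy equivalence is an equivalence relation. *)
Lemma hclass_eq (A K : C) (X Y : cpx n A K) :
  htpy_equiv X Y <-> hclass X = hclass Y.
Proof.
split=> [XY|e]; last first.
  by have : hclass Y Y := htpy_refl Y; rewrite -e.
apply/seteqP; split=> Z; rewrite /hclass /=.
  exact/htpy_trans/htpy_sym.
exact: htpy_trans.
Qed.

(** Isomorphic complexes with the same end terms are homotopy equivalent; it is
    enough that one of the two mutually inverse families is a chain map. *)
Lemma iso_htpy (A K : C) (X Y : cpx n A K) (u : forall p, hom (X p) (Y p))
    (v : forall p, hom (Y p) (X p)) :
  u Src = idm A -> u Tgt = idm K ->
  (forall p, v p \oC u p = idm (X p)) -> (forall p, u p \oC v p = idm (Y p)) ->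
  (forall p q, u q \oC dif X p q = dif Y p q \oC u p) -> htpy_equiv X Y.
Proof.
move=> u0 u1 vu uv uC.
have vC p q : v q \oC dif Y p q = dif X p q \oC v p.
  rewrite -[dif Y p q]compm1 -uv !compA -(compA (v q)) -uC !compA.
  by rewrite vu comp1m.
exists (Chmap uC), (Chmap vC); split=> //.
- have := vu Src; have := vu Tgt; rewrite u0 u1 => e1 e0.
  by split; [rewrite -[RHS]e0|rewrite -[RHS]e1]; symmetry; apply: compm1.
- by exists (fun p q => 0) => p /=; rewrite vu subrr compm0 comp0m addr0.
- by exists (fun p q => 0) => p /=; rewrite uv subrr compm0 comp0m addr0.
Qed.

(** The part of the definition of an n-exangle that suffices to build
    homotopies; it does not involve an extension, so it can be checked for
    complexes that are not yet known to realize anything. *)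
Definition hexact (A K : C) (X : cpx n A K) : Prop :=
  forall (W : C) (j : 'I_n) (w : hom (X (Mid j)) W),
  w \oC dif X (prevp (Mid j)) (Mid j) = 0 ->
  exists g, g \oC dif X (Mid j) (nextp (Mid j)) = w.

Lemma contractible_hexact (A K : C) (X : cpx n A K) :
  contractible X -> hexact X.
Proof.
case=> h Hh W j w w0; exists (w \oC h (nextp (Mid j)) (Mid j)).
by rewrite -[RHS]compm1 -[idm _]subr0 Hh compDr !compA w0 comp0m add0r.
Qed.

(** Inductive construction of a contraction of [u], from the source end: what is
    left of [u p] once the part through degree [deg p - 1] is subtracted
    vanishes on the image of the previous differential, hence factors through
    the next one by exactness. *)
Lemma partial_homotopy (A K : C) (X : cpx n A K) (u : chmap X X) :
  hexact X -> u Src = 0 -> forall k, (k <= n)%N ->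
  exists h : forall p q, hom (X p) (X q), forall p, (deg p <= k)%N ->
    u p = dif X (prevp p) p \oC h p (prevp p)
          + h (nextp p) p \oC dif X p (nextp p).
Proof.
move=> exX u0; elim=> [_|k IH kn].
  exists (fun p q => 0) => -[|j|] //= _.
  by rewrite u0 comp0m compm0 addr0.
have {IH} [h Hh] := IH (ltnW kn).
set p0 := at_ n k.+1.
have dp0 : deg p0 = k.+1 by rewrite deg_at // ltnW.
have {}[j p0j] : exists j, p0 = Mid j.
  case: p0 dp0 => [|j|] //; first by exists j.
  by move=> [e]; rewrite e ltnn in kn.
rewrite p0j in dp0.
set p := Mid j in dp0; set w := u p - dif X (prevp p) p \oC h p (prevp p).
have npp : nextp (prevp p) = p by rewrite prevpK.
have /exX [g Hg] : w \oC dif X (prevp p) p = 0.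
  have := Hh (prevp p); rewrite npp deg_pred dp0 leqnn => /(_ isT) e.
  rewrite /w compDl compNl cm_comm e compDr !compA difK comp0m add0r.
  by rewrite subrr.
(* The homotopy found so far, with its component into [p] replaced by [g]. *)
pose h' := dfwith (fun a : pos n * pos n => h a.1 a.2)
  (g : (fun a : pos n * pos n => hom (X a.1) (X a.2) : Type) (nextp p, p)).
have h'E a b : (a, b) != (nextp p, p) -> h' (a, b) = h a b.
  by move=> ab; rewrite /h' dfwith_out // eq_sym.
exists (fun a b => h' (a, b)) => q; rewrite leq_eqVlt => /orP[/eqP dq|dq].
  have -> : q = p by apply: deg_inj; rewrite dq dp0.
  rewrite h'E; last first.
    rewrite xpair_eqE negb_and; apply/orP; left.
    by apply/eqP => /(congr1 (@deg n)); rewrite deg_succ ?mid_neqT // => /n_Sn.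
  rewrite /h' dfwith_in Hg /w addrC subrK //.
rewrite ltnS in dq; rewrite !h'E; first exact: Hh.
  rewrite xpair_eqE negb_and; apply/orP; right.
  by apply/eqP => e; rewrite e dp0 ltnn in dq.
rewrite xpair_eqE negb_and; apply/orP; left.
apply/eqP => e; rewrite e deg_succ ?mid_neqT // dp0 in dq.
by move: dq; rewrite ltnNge leqnSn.
Qed.

(** The maps [h] of [partial_homotopy] fail to be a contraction of [u] only at
    the last term, where [d_n h] need not vanish.  Composing with [u] repairs
    this, since [d_n u h = u d_n h = 0] there. *)
Lemma square_homotopic0 (A K : C) (X : cpx n A K) (u : chmap X X) :
  hexact X -> u Src = 0 -> u Tgt = 0 ->
  homotopic (fun p => u p \oC u p) (fun p => 0).
Proof.
move=> exX u0 u1; have [h Hh] := partial_homotopy exX u0 (leqnn n).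
exists (fun p q => u q \oC h p q) => p; rewrite subr0.
have [->|pT] := eqVneq p Tgt.
  by rewrite compA -cm_comm u1 !comp0m addr0.
rewrite {2}Hh; first by rewrite compDr !compA cm_comm.
rewrite -ltnS ltn_neqAle deg_le andbT.
by apply: contraNneq pT => e; apply/eqP/deg_inj.
Qed.

(** With [g' = 2g - gfg] one has [1 - g'f = (1 - gf)^2]. *)
Lemma one_minus_square (A B : C) (f : hom A B) (g : hom B A) :
  idm A - (g + (g + - (g \oC (f \oC g)))) \oC f
  = (idm A + - (g \oC f)) \oC (idm A + - (g \oC f)).
Proof.
rewrite !(compDl, compDr, compNl, compNr) !comp1m !compm1 !compA !opprD !opprK.
by rewrite -!addrA.
Qed.

Lemma one_minus_square_op (A B : C) (f : hom A B) (g : hom B A) :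
  idm B - f \oC (g + (g + - (g \oC (f \oC g))))
  = (idm B + - (f \oC g)) \oC (idm B + - (f \oC g)).
Proof.
rewrite !(compDl, compDr, compNl, compNr) !comp1m !compm1 !compA !opprD !opprK.
by rewrite -!addrA.
Qed.

(** The maps [1 - gf] and [1 - fg] vanish on the end terms, so their squares are
    null-homotopic, and these squares are [1 - g'f] and [1 - fg'] for
    [g' = 2g - gfg]. *)
Lemma htpy_of_maps (A K : C) (X Y : cpx n A K) (f : chmap X Y) (g : chmap Y X) :
  hexact X -> hexact Y -> fix_ends f -> fix_ends g -> htpy_equiv X Y.
Proof.
move=> exX exY [f0 f1] [g0 g1].
pose g' := chadd g (chadd g (chopp (chcomp g (chcomp f g)))).
exists f, g'; split=> //.
- by rewrite /= f0 f1 g0 g1 !comp1m !subrr !addr0.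
- pose u := chadd (chid X) (chopp (chcomp g f)).
  apply: (@homotopic_of_diff _ _ _ _ _ _ _ _ (fun p => u p \oC u p)).
    by apply: square_homotopic0 => //=; rewrite ?f0 ?g0 ?f1 ?g1 comp1m subrr.
  by move=> p; apply: one_minus_square.
- pose u := chadd (chid Y) (chopp (chcomp f g)).
  apply: (@homotopic_of_diff _ _ _ _ _ _ _ _ (fun p => u p \oC u p)).
    by apply: square_homotopic0 => //=; rewrite ?f0 ?g0 ?f1 ?g1 comp1m subrr.
  by move=> p; apply: one_minus_square_op.
Qed.

End Homotopies.

(** * Complexes from families of objects indexed by positions *)

Section Fold.
Context {n : nat} {C : preadd} (P : pos n -> C).

(** In a complex the end terms are parameters of the type, so that the term at
    a variable position [p] is convertible to [P p] only after a case analysis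
    on [p].  The isomorphisms [fold] and [unfold], identities at each position,
    absorb this mismatch. *)
Definition wends (p : pos n) : C := with_ends (P Src) (fun j => P (Mid j)) (P Tgt) p.

Definition fold (p : pos n) : hom (P p) (wends p) :=
  match p with Src => idm _ | Mid j => idm _ | Tgt => idm _ end.
Definition unfold (p : pos n) : hom (wends p) (P p) :=
  match p with Src => idm _ | Mid j => idm _ | Tgt => idm _ end.

Lemma unfoldK p : fold p \oC unfold p = idm (wends p).
Proof. by case: p => [|j|] /=; rewrite comp1m. Qed.

Lemma foldK p : unfold p \oC fold p = idm (P p).
Proof. by case: p => [|j|] /=; rewrite comp1m. Qed.

Context (d : forall p q, hom (P p) (P q)).
Hypothesis d_shape : forall p q, deg q != (deg p).+1 -> d p q = 0.
Hypothesis dK : forall p q r, d q r \oC d p q = 0.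

Lemma mk_shape p q : deg q != (deg p).+1 -> fold q \oC d p q \oC unfold p = 0.
Proof. by move=> /d_shape ->; rewrite compm0 comp0m. Qed.

Lemma mk_difK p q r :
  (fold r \oC d q r \oC unfold q) \oC (fold q \oC d p q \oC unfold p) = 0.
Proof.
rewrite !compA -(compA _ (unfold q)) foldK compm1 -(compA _ (d q r)) dK.
by rewrite compm0 comp0m.
Qed.

Definition mkcpx : cpx n (P Src) (P Tgt) :=
  @Cpx n C (P Src) (P Tgt) (fun j => P (Mid j))
    (fun p q => fold q \oC d p q \oC unfold p) mk_shape mk_difK.

Lemma mkcpx_dif p q : dif mkcpx p q = fold q \oC d p q \oC unfold p.
Proof. by []. Qed.

Definition to_mk (A K : C) (X : cpx n A K) (f : forall p, hom (X p) (P p))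
  (H : forall p q, f q \oC dif X p q = d p q \oC f p) : chmap X mkcpx.
Proof.
exists (fun p => (fold p \oC f p : hom (X p) (mkcpx p))) => p q.
rewrite mkcpx_dif -!compA H (compA (unfold p)) foldK comp1m //.
Defined.

Definition from_mk (A K : C) (X : cpx n A K) (f : forall p, hom (P p) (X p))
  (H : forall p q, f q \oC d p q = dif X p q \oC f p) : chmap mkcpx X.
Proof.
exists (fun p => (f p \oC unfold p : hom (mkcpx p) (X p))) => p q.
by rewrite mkcpx_dif !compA -(compA (f q)) foldK compm1 H.
Defined.

Lemma mkcpx_hexact :
  (forall W p (w : hom (P p) W), p != Src -> p != Tgt ->
   w \oC d (prevp p) p = 0 -> exists g, g \oC d p (nextp p) = w) ->
  hexact mkcpx.
Proof.
move=> H W j w; rewrite mkcpx_dif => w0.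
have [|//||g Hg] := H W (Mid j) w; rewrite ?mid_neqT //.
  move: w0 => /(congr1 (fun g => g \oC fold (prevp (Mid j)))).
  by rewrite comp0m -!compA foldK compm1 /= comp1m.
exists (g \oC unfold (nextp (Mid j))); rewrite mkcpx_dif !compA.
by rewrite -(compA g) foldK compm1 Hg compm1.
Qed.

End Fold.

(** * Transport along isomorphisms *)

(** Bundling the target with the isomorphism allows one to change a single term
    of a complex, by modifying a family of isomorphisms at one position. *)
Record iso_from (C : preadd) (A : C) : Type := IsoFrom {
  itgt :> C;
  fwd : hom A itgt;
  bwd : hom itgt A;
  fwdK : bwd \oC fwd = idm A;
  bwdK : fwd \oC bwd = idm itgt }.

Definition iso_refl (C : preadd) (A : C) : iso_from A :=
  IsoFrom (comp1m (idm A)) (comp1m (idm A)).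

Section Conj.
Context {n : nat} {C : preadd} {A K : C} (X : cpx n A K).
Context (t : forall p, iso_from (X p)).

Let P (p : pos n) : C := t p.
Let d p q : hom (P p) (P q) := fwd (t q) \oC dif X p q \oC bwd (t p).

Lemma conj_shape p q : deg q != (deg p).+1 -> d p q = 0.
Proof. by move=> /(dif_shape X) e; rewrite /d e compm0 comp0m. Qed.

Lemma conj_difK p q r : d q r \oC d p q = 0.
Proof.
rewrite /d !compA -(compA _ (bwd (t q))) fwdK compm1 -(compA _ (dif X q r)) difK.
by rewrite compm0 comp0m.
Qed.

Definition conj_cpx : cpx n (t Src) (t Tgt) := mkcpx conj_shape conj_difK.

Lemma to_conjP p q : fwd (t q) \oC dif X p q = d p q \oC fwd (t p).
Proof. by rewrite /d -!compA fwdK compm1. Qed.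
Lemma from_conjP p q : bwd (t q) \oC d p q = dif X p q \oC bwd (t p).
Proof. by rewrite /d !compA fwdK comp1m. Qed.

Definition to_conj : chmap X conj_cpx := to_mk conj_shape conj_difK to_conjP.
Definition from_conj : chmap conj_cpx X := from_mk conj_shape conj_difK from_conjP.

Lemma to_conjK p : from_conj p \oC to_conj p = idm (X p).
Proof. by rewrite /= !compA -(compA _ (unfold _ p)) foldK compm1 fwdK. Qed.
Lemma from_conjK p : to_conj p \oC from_conj p = idm (conj_cpx p).
Proof. by rewrite /= !compA -(compA _ (fwd _)) bwdK compm1 unfoldK. Qed.
End Conj.

(** * Direct sums of complexes *)

Section DirectSum.
Context {n : nat} {C : preadd} {A K A' K' : C} (X : cpx n A K) (Y : cpx n A' K').
Context (b : forall p, biproduct (X p) (Y p)).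

Let P (p : pos n) : C := b p.
Let d p q : hom (P p) (P q) :=
  in1 (b q) \oC dif X p q \oC pr1 (b p) + in2 (b q) \oC dif Y p q \oC pr2 (b p).

Lemma dsum_in1 p q : in1 (b q) \oC dif X p q = d p q \oC in1 (b p).
Proof.
by rewrite /d compDl -!compA pr1_in1 pr2_in1 !compm0 compm1 addr0.
Qed.
Lemma dsum_in2 p q : in2 (b q) \oC dif Y p q = d p q \oC in2 (b p).
Proof.
by rewrite /d compDl -!compA pr1_in2 pr2_in2 !compm0 compm1 add0r.
Qed.
Lemma dsum_pr1 p q : pr1 (b q) \oC d p q = dif X p q \oC pr1 (b p).
Proof. by rewrite /d compDr !compA pr1_in1 pr1_in2 !comp0m comp1m addr0. Qed.
Lemma dsum_pr2 p q : pr2 (b q) \oC d p q = dif Y p q \oC pr2 (b p).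
Proof. by rewrite /d compDr !compA pr2_in1 pr2_in2 !comp0m comp1m add0r. Qed.

Lemma dsum_shape p q : deg q != (deg p).+1 -> d p q = 0.
Proof.
move=> pq; rewrite /d (dif_shape X pq) (dif_shape Y pq).
by rewrite !compm0 !comp0m addr0.
Qed.

Lemma dsum_difK p q r : d q r \oC d p q = 0.
Proof.
rewrite {2}/d compDr !compA -dsum_in1 -dsum_in2 -(compA _ (dif X q r)).
by rewrite -(compA _ (dif Y q r)) !difK !compm0 !comp0m addr0.
Qed.

Definition dsum : cpx n (b Src) (b Tgt) := mkcpx dsum_shape dsum_difK.

Definition ds_in1 : chmap X dsum := to_mk dsum_shape dsum_difK dsum_in1.
Definition ds_in2 : chmap Y dsum := to_mk dsum_shape dsum_difK dsum_in2.
Definition ds_pr1 : chmap dsum X := from_mk dsum_shape dsum_difK dsum_pr1.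
Definition ds_pr2 : chmap dsum Y := from_mk dsum_shape dsum_difK dsum_pr2.

Lemma dsum_hexact : hexact X -> hexact Y -> hexact dsum.
Proof.
move=> exX exY; apply: mkcpx_hexact => W -[|j|]; rewrite ?eqxx // => w _ _ w0.
have /exX [g1 H1] : (w \oC in1 (b (Mid j))) \oC dif X (prevp (Mid j)) (Mid j) = 0.
  by rewrite -compA dsum_in1 compA w0 comp0m.
have /exY [g2 H2] : (w \oC in2 (b (Mid j))) \oC dif Y (prevp (Mid j)) (Mid j) = 0.
  by rewrite -compA dsum_in2 compA w0 comp0m.
exists (g1 \oC pr1 (b _) + g2 \oC pr2 (b _)).
rewrite compDl -!compA dsum_pr1 dsum_pr2 !compA H1 H2 -!compA -compDr.
by rewrite in_pr compm1.
Qed.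
End DirectSum.

(** * Recognizing realizations *)

Section Biadd.
Context {C : preadd} (E : biadd C).

Lemma push0 (K A A' : C) (a : hom A A') : push a (0 : E K A) = 0.
Proof. by apply: (addIr (push a (0 : E K A))); rewrite -pushD !add0r. Qed.
Lemma pull0 (K K' A : C) (c : hom K' K) : pull c (0 : E K A) = 0.
Proof. by apply: (addIr (pull c (0 : E K A))); rewrite -pullD !add0r. Qed.
Lemma pull_0m (K K' A : C) (x : E K A) : pull (0 : hom K' K) x = 0.
Proof. by apply: (addIr (pull (0 : hom K' K) x)); rewrite -pull_addm !add0r. Qed.
Lemma push_0m (K A A' : C) (x : E K A) : push (0 : hom A A') x = 0.
Proof. by apply: (addIr (push (0 : hom A A') x)); rewrite -push_addm !add0r. Qed.
End Biadd.

Section Realize.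
Context {n : nat} {C : preadd} {E : biadd C} {s : realization n E}.
Hypothesis rs : exact_realization s.

Lemma real_hexact (A K : C) (x : E K A) (X : cpx n A K) :
  s x = hclass X -> hexact X.
Proof.
move=> /(real_exangle rs) ex W j w w0.
by have [_ _ /(_ j w) [H _] _] := ex W; apply: H.
Qed.

Lemma real_htpy (A K : C) (x : E K A) (X Y : cpx n A K) :
  s x = hclass X -> htpy_equiv X Y -> s x = hclass Y.
Proof. by move=> -> /hclass_eq. Qed.

(** The criterion through which all realizations below are found: for [X] not
    assumed to be an n-exangle, two chain maps relating it to an actual
    realization are enough. *)
Lemma recognize (A K : C) (x : E K A) (X : cpx n A K) :
  hexact X ->
  (forall Z : cpx n A K, s x = hclass Z ->
    (exists f : chmap X Z, fix_ends f) /\ (exists g : chmap Z X, fix_ends g)) ->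
  s x = hclass X.
Proof.
move=> exX H; have [Z sZ] := real_class rs x.
have [[f Hf] [g Hg]] := H Z sZ; apply: (real_htpy sZ).
exact: htpy_of_maps (real_hexact sZ) exX Hg Hf.
Qed.

(** The lifts between [X] and a realization [Z] of the transported extension,
    composed with [f] and [g], have identity end terms. *)
Lemma real_iso (A K A' K' : C) (x : E K A) (X : cpx n A K) (Y : cpx n A' K')
    (f : chmap X Y) (g : chmap Y X) :
  (forall p, g p \oC f p = idm (X p)) -> (forall p, f p \oC g p = idm (Y p)) ->
  s x = hclass X -> s (push (f Src) (pull (g Tgt) x) : E K' A') = hclass Y.
Proof.
move=> gf fg sX; apply: recognize => [W j w w0|Z sZ].
  have /(real_hexact sX) [u Hu] :
      (w \oC f (Mid j)) \oC dif X (prevp (Mid j)) (Mid j) = 0.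
    by rewrite -compA cm_comm compA w0 comp0m.
  exists (u \oC g (nextp (Mid j))); rewrite -compA cm_comm compA Hu.
  by rewrite -compA (fg (Mid j)) compm1.
have gf0 : g Src \oC f Src = idm A := gf Src.
have gf1 : g Tgt \oC f Tgt = idm K := gf Tgt.
split.
  have [|h [h0 h1]] := real_lift rs (a := f Src) (c := f Tgt) sX sZ.
    by rewrite -push_pull -pull_comp gf1 pull_id.
  by exists (chcomp h g); split; rewrite /= ?h0 ?h1; [exact: (fg Src)|exact: (fg Tgt)].
have [|h [h0 h1]] := real_lift rs (a := g Src) (c := g Tgt) sZ sX.
  by rewrite -push_comp gf0 push_id.
by exists (chcomp f h); split; rewrite /= ?h0 ?h1; [exact: (fg Src)|exact: (fg Tgt)].
Qed.

Lemma conj_real (A K : C) (x : E K A) (X : cpx n A K)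
    (t : forall p, iso_from (X p)) :
  s x = hclass X ->
  s (push (fwd (t Src)) (pull (bwd (t Tgt)) x)) = hclass (conj_cpx t).
Proof.
move=> /(real_iso (to_conjK t) (from_conjK t)) /=.
by rewrite comp1m compm1.
Qed.

(** If [Z] realizes the sum of the two extensions, the inclusions and the
    projections of the end terms are morphisms of extensions; their lifts
    assemble to chain maps between the direct sum and [Z]. *)
Lemma dsum_real (A K A' K' : C) (x : E K A) (y : E K' A') (X : cpx n A K)
    (Y : cpx n A' K') (b : forall p, biproduct (X p) (Y p)) :
  s x = hclass X -> s y = hclass Y ->
  s (push (in1 (b Src)) (pull (pr1 (b Tgt)) x)
     + push (in2 (b Src)) (pull (pr2 (b Tgt)) y)) = hclass (dsum b).
Proof.
set b0 : biproduct A A' := b Src; set b1 : biproduct K K' := b Tgt.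
move=> sX sY; apply: recognize => [|Z sZ].
  by apply: dsum_hexact; [apply: real_hexact sX|apply: real_hexact sY].
split.
  have [|f [f0 f1]] := real_lift rs (a := in1 b0) (c := in1 b1) sX sZ.
    rewrite pullD -!push_pull -!pull_comp pr1_in1 pr2_in1 pull_id pull_0m.
    by rewrite push0 addr0.
  have [|g [g0 g1]] := real_lift rs (a := in2 b0) (c := in2 b1) sY sZ.
    rewrite pullD -!push_pull -!pull_comp pr1_in2 pr2_in2 pull_id pull_0m.
    by rewrite push0 add0r.
  exists (chadd (chcomp f (ds_pr1 b)) (chcomp g (ds_pr2 b))).
  by split; rewrite /= ?f0 ?g0 ?f1 ?g1 !compm1 in_pr.
have [|f [f0 f1]] := real_lift rs (a := pr1 b0) (c := pr1 b1) sZ sX.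
  by rewrite pushD -!push_comp pr1_in1 pr1_in2 push_id push_0m addr0.
have [|g [g0 g1]] := real_lift rs (a := pr2 b0) (c := pr2 b1) sZ sY.
  by rewrite pushD -!push_comp pr2_in1 pr2_in2 push_id push_0m add0r.
exists (chadd (chcomp (ds_in1 b) f) (chcomp (ds_in2 b) g)).
by split; rewrite /= ?f0 ?g0 ?f1 ?g1 !comp1m in_pr.
Qed.

(** For every family [k] of degree [-1] the family [dk + kd] is a chain map. *)
Section Boundary.
Context {A K A' K' : C} (X : cpx n A K) (Y : cpx n A' K').
Context (k : forall p q, hom (X p) (Y q)).

Definition boundary : chmap X Y.
Proof.
exists (fun p => dif Y (prevp p) p \oC k p (prevp p)
                 + k (nextp p) p \oC dif X p (nextp p)).
apply: comm_next => p pT.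
rewrite compDl compDr -(compA (k _ _)) difK compm0 addr0.
by rewrite [in RHS]compA difK comp0m add0r nextpK // compA.
Defined.
End Boundary.

(** A retraction [r] of the first differential of [X] and a section [m] of the
    last differential of [Y] give a chain map [dk + kd], where [k] is [r] in
    degree 1, [m] in degree [n+1], and zero elsewhere.  Its end components are
    [r d_0 = 1] and [d_n m = 1]. *)
Lemma fix_ends_of_retract (A K : C) (X Y : cpx n A K)
    (r : hom (X (at_ n 1)) A) (m : hom K (Y (at_ n n))) : (0 < n)%N ->
  r \oC dif X Src (at_ n 1) = idm A -> dif Y (at_ n n) Tgt \oC m = idm K ->
  exists f : chmap X Y, fix_ends f.
Proof.
move=> n0 Hr Hm.
pose R := @dfwith (pos n) (fun p => hom (X p) A) (fun p => 0) (at_ n 1) r.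
pose M := @dfwith (pos n) (fun q => hom K (Y q)) (fun q => 0) (at_ n n) m.
pose k p q : hom (X p) (Y q) :=
  match q with
  | Src => R p
  | _ => match p with Tgt => M _ | _ => 0 end
  end.
exists (boundary k); split.
  rewrite /= dif_Src comp0m add0r /k /R.
  by change (nextp Src) with (at_ n 1); rewrite dfwith_in.
rewrite /= dif_Tgt compm0 addr0.
change (prevp Tgt) with (at_ n n).
have -> : k Tgt (at_ n n) = m; last by [].
suff -> : k Tgt (at_ n n) = M (at_ n n) by rewrite /M dfwith_in.
by have := atn_neqS n0; rewrite /k; case: (at_ n n).
Qed.

(** A contraction contains a retraction of [d_0] and a section of [d_n].  An
    n-exangle with extension zero has them too, since the identities of its end
    terms are killed by the zero extension. *)
Lemma real_contractible (A K : C) (X : cpx n A K) : (0 < n)%N ->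
  contractible X -> s (0 : E K A) = hclass X.
Proof.
move=> n0 cX; apply: recognize; first exact: contractible_hexact.
move=> Z /(real_exangle rs) exZ.
have [_ _ _ /(_ (idm A)) [/(_ (push0 _ _ _)) [rZ HrZ] _]] := exZ A.
have [_ /(_ (idm K)) [/(_ (pull0 _ _ _)) [mZ HmZ] _] _ _] := exZ K.
have [h Hh] := cX.
split.
  apply: (@fix_ends_of_retract _ _ X Z (h (at_ n 1) Src) mZ) => //.
  by have := Hh Src; rewrite subr0 dif_Src comp0m add0r.
apply: (@fix_ends_of_retract _ _ Z X rZ (h Tgt (at_ n n))) => //.
by have := Hh Tgt; rewrite subr0 dif_Tgt compm0 addr0.
Qed.

(** An inflation is by definition the differential from [Src] to [at_ n 1],
    whose target is not convertible to [P (at_ n 1)] for a variable [n]. *)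
Lemma inflation_at (P : pos n -> C) (d : forall p q, hom (P p) (P q))
    (Hs : forall p q, deg q != (deg p).+1 -> d p q = 0)
    (HK : forall p q r, d q r \oC d p q = 0) (q : pos n) : q = at_ n 1 -> conflation s (mkcpx Hs HK) ->
  inflation s (d Src q).
Proof.
move=> e cX; suff : inflation s (dif (mkcpx Hs HK) Src q).
  by case: q e => [|j|] e; rewrite mkcpx_dif /= comp1m compm1.
by rewrite e; constructor.
Qed.

Lemma deflation_at (P : pos n -> C) (d : forall p q, hom (P p) (P q))
    (Hs : forall p q, deg q != (deg p).+1 -> d p q = 0)
    (HK : forall p q r, d q r \oC d p q = 0) (q : pos n) : q = at_ n n -> conflation s (mkcpx Hs HK) ->
  deflation s (d q Tgt).
Proof.
move=> e cX; suff : deflation s (dif (mkcpx Hs HK) q Tgt).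
  by case: q e => [|j|] e; rewrite mkcpx_dif /= comp1m compm1.
by rewrite e; constructor.
Qed.

(** Transport of the conflation along the isomorphisms [a] in degree 0 and [b]
    in degree 1, all other terms being kept. *)
Lemma inflation_iso (A K : C) (X : cpx n A K) (a : iso_from A)
    (b : iso_from (X (at_ n 1))) : conflation s X ->
  inflation s (fwd b \oC dif X Src (at_ n 1) \oC bwd a).
Proof.
move=> [x sX].
pose t0 p := iso_refl (X p).
pose t1 := @dfwith (pos n) (fun p => iso_from (X p)) t0 Src a.
pose t := @dfwith (pos n) (fun p => iso_from (X p)) t1 (at_ n 1) b.
have cX : conflation s (conj_cpx t) by eexists; apply: conj_real sX.
have := inflation_at (erefl _) cX; rewrite /t dfwith_in.
rewrite dfwith_out; last exact: (nextp_neqS (@Src n)).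
by rewrite /t1 dfwith_in.
Qed.

Lemma deflation_iso (A K : C) (X : cpx n A K) (a : iso_from K)
    (b : iso_from (X (at_ n n))) : conflation s X ->
  deflation s (fwd a \oC dif X (at_ n n) Tgt \oC bwd b).
Proof.
move=> [x sX].
pose t0 p := iso_refl (X p).
pose t1 := @dfwith (pos n) (fun p => iso_from (X p)) t0 Tgt a.
pose t := @dfwith (pos n) (fun p => iso_from (X p)) t1 (at_ n n) b.
have cX : conflation s (conj_cpx t) by eexists; apply: conj_real sX.
have := deflation_at (erefl _) cX; rewrite /t dfwith_in.
rewrite dfwith_out; last exact: (prevp_neqT (@Tgt n)).
by rewrite /t1 dfwith_in.
Qed.

End Realize.

(** * Biproducts *)

Section Biproducts.
Context {C : preadd}.

Lemma is_zeroP (Z : C) : is_zero Z <-> idm Z = 0.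
Proof.
split=> [zZ|e A]; first by have [H _] := zZ Z; apply: H.
split=> f; first by rewrite -[f]compm1 e compm0.
by rewrite -[f]comp1m e comp0m.
Qed.

Definition bip_swap (A B : C) (b : biproduct A B) : biproduct B A.
Proof.
apply: (@Biproduct C B A b (in2 b) (in1 b) (pr2 b) (pr1 b)).
- exact: pr2_in2.
- exact: pr1_in1.
- exact: pr2_in1.
- exact: pr1_in2.
- by rewrite addrC in_pr.
Defined.

(** The carrier [B] is an arbitrary object isomorphic to [A], so that closure
    under isomorphisms becomes a case of closure under biproducts. *)
Definition bip_iso0 (A B Z : C) (zZ : is_zero Z) (f : hom A B) (g : hom B A)
  (gf : g \oC f = idm A) (fg : f \oC g = idm B) : biproduct A Z.
Proof.
apply: (@Biproduct C A Z B f 0 g 0) => //; rewrite ?comp0m ?compm0 ?addr0 //.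
by symmetry; apply/is_zeroP.
Defined.

Definition bip0r (A Z : C) (zZ : is_zero Z) : biproduct A Z :=
  bip_iso0 zZ (comp1m (idm A)) (comp1m (idm A)).

Definition bip0l (Z A : C) (zZ : is_zero Z) : biproduct Z A :=
  bip_swap (bip0r A zZ).

Lemma bip_zero (A B : C) (b : biproduct A B) :
  is_zero A -> is_zero B -> is_zero b.
Proof.
move=> /is_zeroP a0 /is_zeroP b0; apply/is_zeroP.
rewrite -in_pr -[in1 b]compm1 a0 -[in2 b]compm1 b0.
by rewrite !compm0 !comp0m addr0.
Qed.

Lemma bip_in1K (A B : C) (b : biproduct A B) :
  is_zero B -> in1 b \oC pr1 b = idm b.
Proof.
move=> /is_zeroP b0; have := in_pr b.
by rewrite -[in2 b]compm1 b0 compm0 comp0m addr0.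
Qed.

Lemma pr1_in1A (A B D : C) (b : biproduct A B) (f : hom D A) :
  pr1 b \oC (in1 b \oC f) = f.
Proof. by rewrite compA pr1_in1 comp1m. Qed.
Lemma pr2_in2A (A B D : C) (b : biproduct A B) (f : hom D B) :
  pr2 b \oC (in2 b \oC f) = f.
Proof. by rewrite compA pr2_in2 comp1m. Qed.
Lemma pr1_in2A (A B D : C) (b : biproduct A B) (f : hom D B) :
  pr1 b \oC (in2 b \oC f) = 0.
Proof. by rewrite compA pr1_in2 comp0m. Qed.
Lemma pr2_in1A (A B D : C) (b : biproduct A B) (f : hom D A) :
  pr2 b \oC (in1 b \oC f) = 0.
Proof. by rewrite compA pr2_in1 comp0m. Qed.

Definition bipE := (pr1_in1A, pr2_in2A, pr1_in2A, pr2_in1A, @pr1_in1 C,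
  @pr2_in2 C, @pr1_in2 C, @pr2_in1 C, @comp0m C, @compm0 C, @comp1m C, @compm1 C).

Lemma bip_ext (A B D : C) (b : biproduct A B) (u v : hom b D) :
  u \oC in1 b = v \oC in1 b -> u \oC in2 b = v \oC in2 b -> u = v.
Proof.
by move=> e1 e2; rewrite -[u]compm1 -[v]compm1 -in_pr !compDr !compA e1 e2.
Qed.

(** The canonical isomorphism from [(U + V) + W] to [U + (W + V)]. *)
Lemma bip_assoc_iso (U V W : C) (b1 : biproduct U V) (b : biproduct b1 W)
    (c : biproduct W V) (b' : biproduct U c) :
  exists f : hom b b', is_iso f.
Proof.
exists (in1 b' \oC (pr1 b1 \oC pr1 b)
  + in2 b' \oC (in2 c \oC (pr2 b1 \oC pr1 b) + in1 c \oC pr2 b)).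
exists (in1 b \oC (in1 b1 \oC pr1 b' + in2 b1 \oC (pr2 c \oC pr2 b'))
  + in2 b \oC (pr1 c \oC pr2 b')).
have E := (@compDl C, @compDr C).
split; apply: bip_ext.
- apply: bip_ext; rewrite !E -!compA; do !rewrite ?E ?bipE ?addr0 ?add0r //.
- rewrite !E -!compA; do !rewrite ?E ?bipE ?addr0 ?add0r //.
- rewrite !E -!compA; do !rewrite ?E ?bipE ?addr0 ?add0r //.
- apply: bip_ext; rewrite !E -!compA; do !rewrite ?E ?bipE ?addr0 ?add0r //.
Qed.
End Biproducts.

(** * Elementary contractible complexes *)

Lemma mkcpx_contractible n (C : preadd) (P : pos n -> C)
    (d : forall p q, hom (P p) (P q))
    (Hs : forall p q, deg q != (deg p).+1 -> d p q = 0)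
    (HK : forall p q r, d q r \oC d p q = 0) (h : forall p q, hom (P p) (P q)) :
  (forall p, idm (P p) = d (prevp p) p \oC h p (prevp p)
                         + h (nextp p) p \oC d p (nextp p)) ->
  contractible (mkcpx Hs HK).
Proof.
move=> Hh; exists (fun p q => fold P q \oC h p q \oC unfold P p) => p.
rewrite !mkcpx_dif subr0 !compA -!(compA _ (unfold P _) (fold P _)) !foldK.
by rewrite !compm1 -compDl -!(compA (fold P p)) -compDr -Hh compm1 unfoldK.
Qed.

(** The complex [T_0 -> T_1 + T_0 -> T_2 + T_1 -> ...], in which each
    differential is the projection to [T_k] followed by its inclusion.  It is
    indexed by natural numbers first, where the contraction is a uniform
    formula, and then restricted to the positions [0, ..., n+1]. *)
Section Elementary.
Context {n : nat} {C : preadd} (T : nat -> C).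
Context (b : forall k, biproduct (T k.+1) (T k)).

Definition eob (i : nat) : C := if i is k.+1 then b k else T 0.

Definition edif (i : nat) : hom (eob i) (eob i.+1) :=
  match i with
  | 0 => in2 (b 0)
  | k.+1 => in2 (b k.+1) \oC pr1 (b k)
  end.

Definition ehtp (i : nat) : hom (eob i.+1) (eob i) :=
  match i with
  | 0 => pr2 (b 0)
  | k.+1 => in1 (b k) \oC pr2 (b k.+1)
  end.

Lemma edifK i : edif i.+1 \oC edif i = 0.
Proof. by case: i => [|i] /=; rewrite -!compA !bipE. Qed.

Lemma ehtp0 : ehtp 0 \oC edif 0 = idm (eob 0).
Proof. by rewrite /= bipE. Qed.

Lemma ehtpS i : edif i \oC ehtp i + ehtp i.+1 \oC edif i.+1 = idm (eob i.+1).
Proof. by case: i => [|i] /=; rewrite -!compA !bipE addrC in_pr. Qed.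

(** The complex stops at [b i], which is isomorphic to [T_i] if [T_{i+1}]
    vanishes; then the contraction identity has a single summand. *)
Lemma ehtp_last i : is_zero (T i.+1) -> edif i \oC ehtp i = idm (eob i.+1).
Proof.
move=> z; have e : pr1 (b i) = 0 by have [_] := z (b i); apply.
by rewrite -ehtpS [edif i.+1]/= e !compm0 addr0.
Qed.

Let P (p : pos n) : C := eob (deg p).

(* [edif] and [ehtp] as matrices indexed by all pairs of degrees, which avoids
   transporting along equations between degrees. *)
Definition etot i : forall j, hom (eob i) (eob j) :=
  @dfwith nat (fun j => hom (eob i) (eob j)) (fun j => 0) i.+1 (edif i).

Definition etot_htp i : forall j, hom (eob i) (eob j) :=
  match i with
  | 0 => fun j => 0
  | k.+1 => @dfwith nat (fun j => hom (eob k.+1) (eob j)) (fun j => 0) k (ehtp k)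
  end.

Lemma etotS i : etot i i.+1 = edif i. Proof. exact: dfwith_in. Qed.
Lemma etot_htpS i : etot_htp i.+1 i = ehtp i. Proof. exact: dfwith_in. Qed.

Lemma etot_shape (p q : pos n) : deg q != (deg p).+1 -> etot (deg p) (deg q) = 0.
Proof. by move=> pq; rewrite /etot dfwith_out // eq_sym. Qed.

Lemma etotK (p q r : pos n) : etot (deg q) (deg r) \oC etot (deg p) (deg q) = 0.
Proof.
rewrite /etot; case: dfwithP => [|j ne]; last by rewrite comp0m.
by case: dfwithP => [|j ne]; rewrite ?compm0 ?edifK.
Qed.

Definition elem : cpx n (T 0) (b n) := @mkcpx n C P _ etot_shape etotK.

Lemma elem_contractible : is_zero (T n.+1) -> contractible elem.
Proof.
move=> zT; apply: (@mkcpx_contractible _ _ _ _ _ _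
  (fun p q => etot_htp (deg p) (deg q))) => p.
have [->|pT] := eqVneq p Tgt.
  rewrite (etot_shape (q := nextp Tgt)); last by rewrite neq_ltn ltnS deg_le.
  by rewrite compm0 addr0 deg_pred (etotS n) (etot_htpS n) ehtp_last.
rewrite deg_succ // deg_pred etotS etot_htpS.
case: (deg p) => [|i]; first by rewrite compm0 add0r ehtp0.
by rewrite (etotS i) (etot_htpS i) ehtpS.
Qed.
End Elementary.

(** * Closure properties of dense and complete subcategories *)

Section DenseComplete.
Context {n : nat} {C : preadd} {E : biadd C} {s : realization n E} {S : set C}.
Hypothesis nodd : odd n.
Hypothesis Hs : nexangulated s.
Hypothesis Sd : dense S.
Hypothesis Sc : complete s S.

Let n0 : (0 < n)%N := nex_gt0 Hs.
Let rs : exact_realization s := nex_real Hs.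

Lemma elem_real (T : nat -> C) (b : forall k, biproduct (T k.+1) (T k)) :
  is_zero (T n.+1) -> s (0 : E (b n) (T 0)) = hclass (elem b).
Proof. by move=> zT; apply: (real_contractible rs n0); apply: elem_contractible. Qed.

Lemma elem_complete (T : nat -> C) (b : forall k, biproduct (T k.+1) (T k))
    (p : pos n) :
  is_zero (T n.+1) -> (forall q, q != p -> S (eob b (deg q))) -> S (eob b (deg p)).
Proof.
move=> zT Sq; have wE q : elem b q = eob b (deg q) by case: q.
rewrite -wE; apply: (Sc (ex_intro _ _ (elem_real b zT))) => q qp.
by rewrite wE; apply: Sq.
Qed.

(** The only use of the parity of [n]: the complex [A = A -> A = A -> ... -> 0]
    with [n + 1] terms [A], linked in pairs by identities, is contractible. *)
Lemma sub_zero : exists Z, is_zero Z /\ S Z.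
Proof.
have [[Z zZ] _] := nex_additive Hs; exists Z; split=> //.
have [A' [bA SA]] := Sd Z; set A : C := bA in SA.
(* Beyond [n] the sequence must vanish, whatever the parity. *)
pose T i := if odd i || (n < i)%N then Z else A.
have bP k : exists b : biproduct (T k.+1) (T k), bob b = if (k < n)%N then A else Z.
  rewrite /T /=; have [kn|nk] := ltnP k n.
    rewrite ltnNge kn ltnNge (ltnW kn) !orbF.
    by case: (odd k); [exists (bip0r A zZ)|exists (bip0l A zZ)].
  have -> : odd k || (n < k)%N.
    by move: nk; rewrite leq_eqVlt => /orP[/eqP <-|->]; rewrite ?nodd ?orbT.
  by rewrite ltnS nk orbT; exists (bip0r Z zZ).
pose b k := sval (cid (bP k)).
have bE k : bob (b k) = if (k < n)%N then A else Z := svalP (cid (bP k)).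
have := @elem_complete T b Tgt; rewrite /= bE ltnn; apply.
  by rewrite /T ltnSn orbT.
by case=> [|j|]; rewrite ?eqxx //= bE ltn_ord.
Qed.

(** The complex [A -> A + B -> B -> 0 -> ... -> 0] is a conflation. *)
Lemma sub_bip (A B : C) (b : biproduct A B) : S A -> S B -> S b.
Proof.
move=> SA SB; have [Z [zZ SZ]] := sub_zero.
pose T i := match i with 0 => A | 1 => B | _ => Z end.
pose bb k : biproduct (T k.+1) (T k) :=
  match k with 0 => bip_swap b | 1 => bip0l B zZ | _ => bip0r Z zZ end.
have d1 : deg (at_ n 1) = 1%N by rewrite deg_at.
have := @elem_complete T bb (at_ n 1); rewrite d1; apply => [|q q1].
  by rewrite /T; case: (n) n0.
have : deg q != 1%N by apply: contraNneq q1 => e; apply/eqP/deg_inj; rewrite d1.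
by case: (deg q) => [|[|[|k]]].
Qed.

Lemma sub_iso_closed : iso_closed S.
Proof.
move=> A B f [g [gf fg]] SA; have [Z [zZ SZ]] := sub_zero.
exact: (@sub_bip A Z (bip_iso0 zZ gf fg)).
Qed.

Lemma full_sub_bip (A B : full_sub S) (b : biproduct (sval A) (sval B)) :
  inhabited (biproduct A B).
Proof.
have Sb : S b by apply: sub_bip; apply: svalP.
by split; exact (@Biproduct (full_sub S) A B (exist _ (bob b) Sb)
  (in1 b) (in2 b) (pr1 b) (pr2 b) (pr1_in1 b) (pr2_in2 b) (pr1_in2 b) (pr2_in1 b)
  (in_pr b)).
Qed.

Lemma sub_additive : is_additive (full_sub S).
Proof.
split.
  have [Z [zZ SZ]] := sub_zero; exists (exist _ Z SZ) => A.
  by split=> f; have [H1 H2] := zZ (sval A); [apply: H1|apply: H2].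
by move=> A B; have [_ /(_ (sval A) (sval B)) [b]] := nex_additive Hs;
  apply: full_sub_bip b.
Qed.

(** * Padding a conflation *)

(** [S] contains the term [U + T_{k-1} + T_k] of degree [k] of the direct sum of
    a complex with the elementary complex of [T].  In this bracketing [T_k] can
    be chosen by density once [T_{k-1}] is known. *)
Definition pad_ob (U : C) (T : nat -> C) (k : nat) : Prop :=
  match k with
  | 0 => exists b : biproduct U (T 0), S b
  | k.+1 => exists (b1 : biproduct U (T k)) (b : biproduct b1 (T k.+1)), S b
  end.

(** The elementary complex of [T] vanishes in degree [k]. *)
Definition pad_zero (T : nat -> C) (k : nat) : Prop :=
  match k with 0 => is_zero (T 0) | k.+1 => is_zero (T k) /\ is_zero (T k.+1) end.

(** The choice of biproducts does not matter, as [S] is closed under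
    isomorphisms. *)
Lemma pad_obP U T k (b : forall k, biproduct (T k.+1) (T k))
  (c : biproduct U (eob b k)) : pad_ob U T k -> S c.
Proof.
case: k c => [|k] /= c.
  case=> b0 Sb0; have [Z [zZ SZ]] := sub_zero.
  have [f Hf] := @bip_assoc_iso C U Z (T 0) (bip0r U zZ) b0
    (bip0r (T 0) zZ) c.
  exact: sub_iso_closed Hf Sb0.
case=> b1 [b2 Sb2]; have [f Hf] := bip_assoc_iso b2 c.
exact: sub_iso_closed Hf Sb2.
Qed.

Lemma pad_ob_zero U T k : S U -> pad_zero T k -> pad_ob U T k.
Proof.
case: k => [|k] SU /=; first by move=> z0; exists (bip0r U z0).
case=> z0 z1; exists (bip0r U z0); exists (bip0r _ z1); exact: SU.
Qed.

(** [X'] is the direct sum of [X] with the elementary complex of [T], and [i]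
    and [r] are the inclusion of [X] and the projection to it.  They are inverse
    isomorphisms in those degrees in which the elementary complex vanishes. *)
Lemma padding (A K : C) (x : E K A) (X : cpx n A K) (T : nat -> C) (p0 : pos n) :
  s x = hclass X -> is_zero (T n.+1) ->
  (forall p, p != p0 -> pad_ob (X p) T (deg p)) ->
  exists (A' K' : C) (X' : cpx n A' K') (i : chmap X X') (r : chmap X' X),
  [/\ forall p, S (X' p), s (push (i Src) (pull (r Tgt) x)) = hclass X',
      forall p, r p \oC i p = idm (X p) &
      forall p, pad_zero T (deg p) -> i p \oC r p = idm (X' p)].
Proof.
move=> sX zT padX; have [_ bip] := nex_additive Hs.
have bip' (U V : C) : biproduct U V.
  by have /cid [] : exists b : biproduct U V, True by have [b] := bip U V; exists b.
pose b k := bip' (T k.+1) (T k); pose c p := bip' (X p) (elem b p).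
have sD := dsum_real rs c sX (elem_real b zT).
rewrite pull0 push0 addr0 in sD.
exists (c Src), (c Tgt), (dsum c), (ds_in1 c), (ds_pr1 c); split.
- have SD q : q != p0 -> S (dsum c q).
    move=> /padX; case: q => [|j|] Hq; exact: pad_obP Hq.
  move=> p; have [->|/SD//] := eqVneq p p0.
  exact: Sc (ex_intro _ _ sD) _ SD.
- by rewrite /= comp1m compm1.
- move=> p; rewrite /= !compA -(compA (pr1 _)) foldK compm1 pr1_in1 //.
- move=> p zp; have z : is_zero (elem b p).
    by case: p zp => [|j|] //= [z1 z2]; apply: bip_zero.
  by rewrite /= !compA -(compA _ (in1 _)) bip_in1K // compm1 unfoldK.
Qed.


(** * Choosing the padding *)

Lemma dense_choice (Z : C) : is_zero Z ->
  exists tau : C -> C -> C,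
  forall U V, exists (b1 : biproduct U V) (b : biproduct b1 (tau U V)), S b.
Proof.
move=> zZ; have [_ bip] := nex_additive Hs.
have H U V : exists W, exists (b1 : biproduct U V) (b : biproduct b1 W), S b.
  have [b1] := bip U V; have [W [b Sb]] := Sd b1.
  by exists W, b1, b.
exists (fun U V => sval (cid (H U V))) => U V.
exact: svalP (cid (H U V)).
Qed.

(** Choice of the [T_k] for increasing [k] strictly between [l] and [u]; it makes
    the terms of degrees [l+1, ..., u-1] belong to [S]. *)
Lemma ascending_pad (o : nat -> C) (Z : C) (l u : nat) : is_zero Z ->
  exists T : nat -> C, (forall k, (k <= l)%N || (u <= k)%N -> T k = Z) /\
  (forall k, (l <= k)%N -> (k.+1 < u)%N -> pad_ob (o k.+1) T k.+1).
Proof.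
move=> zZ; have [tau Htau] := dense_choice zZ.
pose fix T k := if k is m.+1 then
    if (l <= m)%N && (m.+1 < u)%N then tau (o m.+1) (T m) else Z
  else Z.
exists T; split=> [[|k] //=|k lk ku /=]; last by rewrite lk ku; apply: Htau.
by case: ltnP => //= kl uk; rewrite ltnNge uk.
Qed.

(** Choice of the [T_k] for decreasing [k < m].  Here [T_{k+1}] is known when
    [T_k] is chosen, so the bracketing of [pad_ob] has to be changed. *)
Lemma descending_pad (o : nat -> C) (Z : C) (m : nat) : is_zero Z ->
  exists T : nat -> C, (forall k, (m <= k)%N -> T k = Z) /\
  (forall k, (k < m)%N -> pad_ob (o k.+1) T k.+1).
Proof.
move=> zZ; have [tau Htau] := dense_choice zZ.
(* [R i] is [T_(m - i)]: the recursion runs downwards from [m]. *)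
pose fix R i := if i is j.+1 then tau (o (m - j)%N) (R j) else Z.
exists (fun k => R (m - k)%N); split=> [k /eqP -> //|k km].
have e : (m - k = (m - k.+1).+1)%N by rewrite subnSK.
rewrite /pad_ob e /= subKn //; set V := R _.
have [b1 [b Sb]] := Htau (o k.+1) V.
have [_ bip] := nex_additive Hs.
have [c1] := bip (o k.+1) (tau (o k.+1) V); have [c] := bip c1 V.
have [d] := bip V (tau (o k.+1) V).
exists c1, c.
have [d'] := bip (o k.+1) (bip_swap d : biproduct _ _).
have [f Hf] := bip_assoc_iso b (d' : biproduct _ (bip_swap d)).
have Sd' := sub_iso_closed Hf Sb.
have [g [h [hg gh]]] := @bip_assoc_iso _ _ _ _ _ c d d'.
by apply: (@sub_iso_closed _ _ h _ Sd'); exists g.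
Qed.

(** With [T_0 = T_n = 0] only the middle terms of a realization are changed, and
    all of them but the one of degree [n] are moved into [S] by the choice of
    [T]; the latter is in [S] by completeness. *)
Lemma sub_extension (A K : C) (x : E K A) : S A -> S K ->
  exists X : cpx n A K, s x = hclass X /\ forall j, S (mid X j).
Proof.
move=> SA SK; have [X sX] := real_class rs x.
have [Z [zZ SZ]] := sub_zero.
have [T [T0 padT]] := ascending_pad (fun k => X (at_ n k)) 0 n zZ.
have T00 : is_zero (T 0) by rewrite T0.
have Tn : is_zero (T n) by rewrite T0 // leqnn orbT.
have Tn1 : is_zero (T n.+1) by rewrite T0 // leqnSn orbT.
have [p|A' [K' [X' [i [r [SX' sX' ri ir]]]]]] := padding (p0 := at_ n n) sX Tn1.
  case: p => [|j|] pn; try exact: pad_ob_zero.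
  have := padT j (leq0n _); rewrite -[j.+1]/(deg (Mid j)) degK; apply.
  rewrite /= ltn_neqAle ltn_ord andbT; apply: contraNneq pn => e.
  by apply/eqP/deg_inj; rewrite deg_at.
have ri0 : r Src \oC i Src = idm A := ri Src.
have ri1 : r Tgt \oC i Tgt = idm K := ri Tgt.
pose t p : iso_from (X' p) :=
  match p with
  | Src => IsoFrom (ir Src T00) (ri Src)
  | Mid j => iso_refl _
  | Tgt => IsoFrom (ir Tgt (conj Tn Tn1)) (ri Tgt)
  end.
exists (conj_cpx t : cpx n A K); split; last by move=> j; apply: (SX' (Mid j)).
rewrite -(conj_real rs t sX') /= -push_pull -push_comp -pull_comp.
by rewrite ri0 ri1 push_id pull_id.
Qed.

(** With [T_0 = T_1 = 0] the terms of degrees 0 and 1 do not change, and the last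
    term is in [S] by completeness. *)
Lemma pad_inflation (A K : C) (X : cpx n A K) :
  conflation s X -> S A -> S (X (at_ n 1)) ->
  exists (A' K' : C) (X' : cpx n A' K') (i : chmap X X') (r : chmap X' X),
  [/\ forall p, S (X' p), conflation s X',
      forall p, r p \oC i p = idm (X p) &
      forall p, (deg p <= 1)%N -> i p \oC r p = idm (X' p)].
Proof.
move=> [x sX] SA S1; have [Z [zZ SZ]] := sub_zero.
have [T [T0 padT]] := ascending_pad (fun k => X (at_ n k)) 1 n.+1 zZ.
have T00 : is_zero (T 0) by rewrite T0.
have T01 : is_zero (T 1) by rewrite T0.
have Tn1 : is_zero (T n.+1) by rewrite T0 // leqnn orbT.
have zero_le1 (p : pos n) : (deg p <= 1)%N -> pad_zero T (deg p).
  by case: (deg p) => [|[|k]].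
have [p|A' [K' [X' [i [r [SX' sX' ri ir]]]]]] := padding (p0 := Tgt) sX Tn1.
  move=> pT; have [p1|p1] := leqP (deg p) 1.
    apply: pad_ob_zero; last exact: zero_le1.
    have [->//|pS] := eqVneq p Src.
    suff -> : p = at_ n 1 by [].
    by apply: deg_inj; rewrite deg_at //; apply/eqP; rewrite eqn_leq p1 deg_gt0.
  have ple : (deg p < n.+1)%N.
    rewrite ltn_neqAle deg_le andbT; apply: contraNneq pT => e.
    exact/eqP/deg_inj.
  by rewrite -{1}[p]degK; case: (deg p) p1 ple => // k; apply: padT.
exists A', K', X', i, r; split=> //; first by eexists; apply: sX'.
by move=> p /zero_le1; apply: ir.
Qed.

(** Dually, with [T_k = 0] for [k >= n-1] the terms of degrees [n] and [n+1] do
    not change, and the first term is in [S] by completeness. *)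
Lemma pad_deflation (A K : C) (X : cpx n A K) :
  conflation s X -> S K -> S (X (at_ n n)) ->
  exists (A' K' : C) (X' : cpx n A' K') (i : chmap X X') (r : chmap X' X),
  [/\ forall p, S (X' p), conflation s X',
      forall p, r p \oC i p = idm (X p) &
      forall p, (n <= deg p)%N -> i p \oC r p = idm (X' p)].
Proof.
move=> [x sX] SK S1; have [Z [zZ SZ]] := sub_zero.
have [T [T0 padT]] := descending_pad (fun k => X (at_ n k)) n.-1 zZ.
have Tz k : (n.-1 <= k)%N -> is_zero (T k) by move=> /T0 ->.
have zero_gen (p : pos n) : (n <= deg p)%N -> pad_zero T (deg p).
  case: (deg p) => [|k]; first by rewrite leqNgt n0.
  by move=> nk; split; apply: Tz; rewrite -subn1 leq_subLR add1n // ltnW.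
have Tn1 : is_zero (T n.+1) by apply: Tz; rewrite -subn1 leq_subLR add1n ltnW.
have [p|A' [K' [X' [i [r [SX' sX' ri ir]]]]]] := padding (p0 := Src) sX Tn1.
  move=> pS; have [np|pn] := leqP n (deg p).
    apply: pad_ob_zero; last exact: zero_gen.
    have [->//|pT] := eqVneq p Tgt.
    suff -> : p = at_ n n by [].
    rewrite -[p]degK; congr at_; apply/eqP; rewrite eqn_leq np andbT.
    rewrite -ltnS ltn_neqAle deg_le andbT; apply: contraNneq pT => e.
    exact/eqP/deg_inj.
  rewrite -{1}[p]degK; case: (deg p) (deg_gt0 pS) pn => // k _ kn.
  by apply: padT; rewrite -ltnS prednK.
exists A', K', X', i, r; split=> //; first by eexists; apply: sX'.
by move=> p /zero_gen; apply: ir.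
Qed.

End DenseComplete.

(** * Isomorphisms of mapping cones and cocones *)

(** Mapping cones and cocones are both complexes whose terms are direct sums of
    an object [U p] and an object [V p], with a lower triangular differential
    given by [a], [c] and [e].  At the ends one of the summands is left out,
    which is recorded by [nU] and [nV].  A complex with such a structure is
    determined up to isomorphism by [a], [c] and [e]. *)
Record twisted n (C : preadd) (nU nV : pred (pos n)) (U V : pos n -> C)
    (a : forall p q, hom (U p) (U q)) (c : forall p q, hom (U p) (V q))
    (e : forall p q, hom (V p) (V q)) (B L : C) (Q : cpx n B L) : Type := Twisted {
  twiU : forall p, hom (U p) (Q p);
  twpU : forall p, hom (Q p) (U p);
  twiV : forall p, hom (V p) (Q p);
  twpV : forall p, hom (Q p) (V p);
  tw_sum : forall p, twiU p \oC twpU p + twiV p \oC twpV p = idm (Q p);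
  tw_dif : forall p q, dif Q p q = twiU q \oC a p q \oC twpU p
    + twiV q \oC c p q \oC twpU p + twiV q \oC e p q \oC twpV p;
  tw_UU : forall p, nU p -> twpU p \oC twiU p = idm (U p);
  tw_VV : forall p, nV p -> twpV p \oC twiV p = idm (V p);
  tw_UV : forall p, twpU p \oC twiV p = 0;
  tw_VU : forall p, twpV p \oC twiU p = 0;
  tw_U0 : forall p, ~~ nU p -> twiU p = 0;
  tw_V0 : forall p, ~~ nV p -> twiV p = 0;
  tw_U0p : forall p, ~~ nU p -> twpU p = 0;
  tw_V0p : forall p, ~~ nV p -> twpV p = 0 }.

Section TwistedIso.
Context {n : nat} {C : preadd} {nU nV : pred (pos n)} {U V : pos n -> C}.
Context {a : forall p q, hom (U p) (U q)} {c : forall p q, hom (U p) (V q)}.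
Context {e : forall p q, hom (V p) (V q)}.

Section Map.
Context {B L B' L' : C} {Q : cpx n B L} {Q' : cpx n B' L'}.
Context (t : twisted nU nV a c e Q) (t' : twisted nU nV a c e Q').

Lemma tw_absU p : twiU t' p \oC (twpU t p \oC twiU t p) = twiU t' p.
Proof.
have [/tw_UU ->|/(tw_U0 t') ->] := boolP (nU p); first by rewrite compm1.
by rewrite comp0m.
Qed.
Lemma tw_absV p : twiV t' p \oC (twpV t p \oC twiV t p) = twiV t' p.
Proof.
have [/tw_VV ->|/(tw_V0 t') ->] := boolP (nV p); first by rewrite compm1.
by rewrite comp0m.
Qed.
Lemma tw_absUp p : twpU t' p \oC twiU t' p \oC twpU t p = twpU t p.
Proof.
have [/tw_UU ->|/(tw_U0p t) ->] := boolP (nU p); first by rewrite comp1m.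
by rewrite compm0.
Qed.
Lemma tw_absVp p : twpV t' p \oC twiV t' p \oC twpV t p = twpV t p.
Proof.
have [/tw_VV ->|/(tw_V0p t) ->] := boolP (nV p); first by rewrite comp1m.
by rewrite compm0.
Qed.

(** The identity matrix with respect to the two decompositions. *)
Definition tw_map : chmap Q Q'.
Proof.
exists (fun p => twiU t' p \oC twpU t p + twiV t' p \oC twpV t p) => p q.
rewrite (tw_dif t) (tw_dif t') !(compDl, compDr).
have R1 : forall W (f : hom W (U q)),
    twiU t' q \oC twpU t q \oC (twiU t q \oC f) = twiU t' q \oC f.
  by move=> W f; rewrite compA -(compA _ (twpU t q)) tw_absU.
have R2 : forall W (f : hom W (V q)),
    twiV t' q \oC twpV t q \oC (twiV t q \oC f) = twiV t' q \oC f.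
  by move=> W f; rewrite compA -(compA _ (twpV t q)) tw_absV.
have R3 : forall W (f : hom W (V q)),
    twiU t' q \oC twpU t q \oC (twiV t q \oC f) = 0.
  by move=> W f; rewrite compA -(compA _ (twpU t q)) tw_UV compm0 comp0m.
have R4 : forall W (f : hom W (U q)),
    twiV t' q \oC twpV t q \oC (twiU t q \oC f) = 0.
  by move=> W f; rewrite compA -(compA _ (twpV t q)) tw_VU compm0 comp0m.
have R5 : forall W (f : hom (U p) W),
    f \oC twpU t' p \oC (twiU t' p \oC twpU t p) = f \oC twpU t p.
  by move=> W f; rewrite -compA [twpU t' p \oC _]compA tw_absUp.
have R6 : forall W (f : hom (V p) W),
    f \oC twpV t' p \oC (twiV t' p \oC twpV t p) = f \oC twpV t p.
  by move=> W f; rewrite -compA [twpV t' p \oC _]compA tw_absVp.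
have R7 : forall W (f : hom (U p) W),
    f \oC twpU t' p \oC (twiV t' p \oC twpV t p) = 0.
  by move=> W f; rewrite -compA [twpU t' p \oC _]compA tw_UV comp0m compm0.
have R8 : forall W (f : hom (V p) W),
    f \oC twpV t' p \oC (twiU t' p \oC twpU t p) = 0.
  by move=> W f; rewrite -compA [twpV t' p \oC _]compA tw_VU comp0m compm0.
rewrite !R5 !R6 !R7 !R8 -!(compA (twiU t q)) -!(compA (twiV t q)).
by rewrite !R1 !R2 !R3 !R4 !(addr0, add0r) !compA addrA.
Defined.
End Map.

Lemma tw_mapK (B L B' L' : C) (Q : cpx n B L) (Q' : cpx n B' L')
    (t : twisted nU nV a c e Q) (t' : twisted nU nV a c e Q') p :
  tw_map t' t p \oC tw_map t t' p = idm (Q p).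
Proof.
rewrite /= !(compDl, compDr) -!compA.
rewrite !(compA (twpU t' p)) !(compA (twpV t' p)) tw_UV tw_VU tw_absUp tw_absVp.
by rewrite !comp0m !compm0 addr0 add0r tw_sum.
Qed.

(** Hence cones formed with different biproducts, or transported by a functor,
    realize the same extension up to the change of end terms. *)
Lemma tw_real (E : biadd C) (s : realization n E) (B L B' L' : C)
    (Q : cpx n B L) (Q' : cpx n B' L') (x : E L B)
    (t : twisted nU nV a c e Q) (t' : twisted nU nV a c e Q') :
  exact_realization s -> s _ _ x = hclass Q ->
  s _ _ (push (tw_map t t' Src) (pull (tw_map t' t Tgt) x) : E L' B') = hclass Q'.
Proof. by move=> rs; apply: (real_iso rs) => p; apply: tw_mapK. Qed.
End TwistedIso.

Section ConeTwisted.
Context {n : nat} {C : preadd} {A K A' K' : C}.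
Context {X : cpx n A K} {Y : cpx n A' K'} (f : chmap X Y).

Definition cone_twisted
    (b : forall j : 'I_n, biproduct (X (nextp (Mid j))) (Y (Mid j))) :
  twisted (fun p => p != Tgt) (fun p => p != Src)
    (fun p q => - dif X (nextp p) (nextp q))
    (fun p q => diag f (nextp p) q) (fun p q => dif Y p q) (cone f b).
Proof.
apply: (@Twisted _ _ _ _ _ _ _ _ _ _ _ (cone f b)
  (cone_inX b) (cone_prX b) (cone_inY b) (cone_prY b)).
- by case=> [|j|] /=; rewrite ?in_pr ?comp1m ?comp0m ?addr0 ?add0r.
- by [].
- exact: cone_prX_inX.
- exact: cone_prY_inY.
- exact: cone_prX_inY.
- exact: cone_prY_inX.
- by case=> [|j|] //; rewrite mid_neqT.
- by case=> [|j|].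
- by case=> [|j|] //; rewrite mid_neqT.
- by case=> [|j|].
Defined.

Definition cocone_twisted
    (b : forall j : 'I_n, biproduct (X (Mid j)) (Y (prevp (Mid j)))) :
  twisted (fun p => p != Tgt) (fun p => p != Src)
    (fun p q => dif X p q) (fun p q => diag f p (prevp q))
    (fun p q => - dif Y (prevp p) (prevp q)) (cocone f b).
Proof.
apply: (@Twisted _ _ _ _ _ _ _ _ _ _ _ (cocone f b)
  (cocone_inX b) (cocone_prX b) (cocone_inY b) (cocone_prY b)).
- by case=> [|j|] /=; rewrite ?in_pr ?comp1m ?comp0m ?addr0 ?add0r.
- by [].
- exact: cocone_prX_inX.
- exact: cocone_prY_inY.
- exact: cocone_prX_inY.
- exact: cocone_prY_inX.
- by case=> [|j|] //; rewrite mid_neqT.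
- by case=> [|j|].
- by case=> [|j|] //; rewrite mid_neqT.
- by case=> [|j|].
Defined.
End ConeTwisted.

(** * Images of complexes under functors *)

Section MapFold.
Context {n : nat} {C D : preadd} (F : functor C D).

Section One.
Context {A K : C} (X : cpx n A K).

(** As for [fold], the terms of the image complex at a variable position are
    convertible to the images of the terms only after a case analysis. *)
Definition mfold (p : pos n) : hom (F (X p)) (map_cpx F X p) :=
  match p with Src => idm (F A) | Mid j => idm (F (mid X j)) | Tgt => idm (F K) end.
Definition munfold (p : pos n) : hom (map_cpx F X p) (F (X p)) :=
  match p with Src => idm (F A) | Mid j => idm (F (mid X j)) | Tgt => idm (F K) end.

Lemma munfoldK p : mfold p \oC munfold p = idm (map_cpx F X p).
Proof. by case: p => [|j|]; rewrite /= comp1m. Qed.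
Lemma mfoldK p : munfold p \oC mfold p = idm (F (X p)).
Proof. by case: p => [|j|]; rewrite /= comp1m. Qed.

Lemma map_difE p q :
  dif (map_cpx F X) p q = mfold q \oC fhom F (dif X p q) \oC munfold p.
Proof.
by case: p => [|i|]; case: q => [|j|]; rewrite /= comp1m compm1.
Qed.

End One.

Lemma fhomN (A B : C) (u : hom A B) : fhom F (- u) = - fhom F u.
Proof. by apply: (addIr (fhom F u)); rewrite -fhomD !addNr fhom0. Qed.

Section Conjugate.
Context {A K A' K' : C} (X : cpx n A K) (Y : cpx n A' K').

(** The functor on morphisms between terms of complexes; it is compatible with
    composition and addition, so that any identity between such morphisms, for
    instance the one defining a chain map or a homotopy, is preserved. *)
Definition mconj p q (u : hom (X p) (Y q)) : hom (map_cpx F X p) (map_cpx F Y q) :=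
  mfold Y q \oC fhom F u \oC munfold X p.

Lemma mconj0 p q : mconj (0 : hom (X p) (Y q)) = 0.
Proof. by rewrite /mconj fhom0 compm0 comp0m. Qed.

Lemma mconjD p q (u v : hom (X p) (Y q)) : mconj (u + v) = mconj u + mconj v.
Proof. by rewrite /mconj fhomD compDr compDl. Qed.
Lemma mconjN p q (u : hom (X p) (Y q)) : mconj (- u) = - mconj u.
Proof. by rewrite /mconj fhomN compNr compNl. Qed.
End Conjugate.

Lemma mconj_comp (A K A' K' A'' K'' : C) (X : cpx n A K) (Y : cpx n A' K')
    (Z : cpx n A'' K'') p q r (v : hom (Y q) (Z r)) (u : hom (X p) (Y q)) :
  @mconj _ _ _ _ X Z p r (v \oC u) = mconj v \oC mconj u.
Proof.
rewrite /mconj fhom_comp !compA; congr (_ \oC _ \oC _).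
by rewrite -!(compA _ (munfold Y q)) mfoldK compm1.
Qed.

Lemma mconj1 (A K : C) (X : cpx n A K) p :
  @mconj _ _ _ _ X X p p (idm (X p)) = idm (map_cpx F X p).
Proof. by rewrite /mconj fhom_id compm1 munfoldK. Qed.

Lemma mapE (A K : C) (X : cpx n A K) p q :
  dif (map_cpx F X) p q = @mconj _ _ _ _ X X p q (dif X p q).
Proof. exact: map_difE. Qed.

Definition map_chmap (A K A' K' : C) (X : cpx n A K) (Y : cpx n A' K')
  (f : chmap X Y) : chmap (map_cpx F X) (map_cpx F Y).
Proof.
exists (fun p => mconj (f p)) => p q.
by rewrite !map_difE -!/(mconj _) -!mconj_comp cm_comm.
Defined.

Lemma map_homotopic (A K A' K' : C) (X : cpx n A K) (Y : cpx n A' K')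
    (u v : forall p, hom (X p) (Y p)) :
  homotopic u v -> homotopic (fun p => mconj (u p)) (fun p => mconj (v p)).
Proof.
case=> h Hh; exists (fun p q => mconj (h p q)) => p.
by rewrite !map_difE -!/(mconj _) -!mconj_comp -mconjN -!mconjD Hh.
Qed.

Lemma map_htpy (A K : C) (X Y : cpx n A K) :
  htpy_equiv X Y -> htpy_equiv (map_cpx F X) (map_cpx F Y).
Proof.
case=> f [g [[f0 f1] [g0 g1] gf fg]].
exists (map_chmap f), (map_chmap g); split.
- by split; rewrite /= /mconj /= ?f0 ?f1 fhom_id comp1m compm1.
- by split; rewrite /= /mconj /= ?g0 ?g1 fhom_id comp1m compm1.
- have [h Hh] := map_homotopic gf; exists h => p.
  by rewrite -Hh mconj_comp mconj1.
- have [h Hh] := map_homotopic fg; exists h => p.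
  by rewrite -Hh mconj_comp mconj1.
Qed.

Section MapTwisted.
Context {A K A' K' : C} {X : cpx n A K} {Y : cpx n A' K'}.
Context (f : chmap X Y) (g : chmap (map_cpx F X) (map_cpx F Y)).
Hypothesis gE : forall p, g p = mconj (f p).

Lemma diag_map p q : diag g p q = mconj (diag f p q).
Proof.
have [<-|pq] := eqVneq p q; first by rewrite !diag_eq gE.
by rewrite !diag_neq // mconj0.
Qed.

(** The image of the cone of [f] decomposes in the same way as the cone of the
    image of [f], for an arbitrary choice of biproducts in each of them. *)
Definition map_cone_twisted
    (b : forall j : 'I_n, biproduct (X (nextp (Mid j))) (Y (Mid j))) :
  twisted (fun p => p != Tgt) (fun p => p != Src)
    (fun p q => - dif (map_cpx F X) (nextp p) (nextp q))
    (fun p q => diag g (nextp p) q) (fun p q => dif (map_cpx F Y) p q)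
    (map_cpx F (cone f b)).
Proof.
pose t := cone_twisted f b; set Q := cone f b in t *.
apply: (@Twisted _ _ _ _ _ _ _ _ _ _ _ (map_cpx F Q)
  (fun p => @mconj _ _ _ _ X Q (nextp p) p (twiU t p))
  (fun p => @mconj _ _ _ _ Q X p (nextp p) (twpU t p))
  (fun p => @mconj _ _ _ _ Y Q p p (twiV t p))
  (fun p => @mconj _ _ _ _ Q Y p p (twpV t p))) => p.
- by rewrite -!mconj_comp -mconjD tw_sum mconj1.
- move=> q; rewrite !mapE diag_map -mconjN -!mconj_comp -!mconjD.
  by rewrite (tw_dif t).
- by move=> H; rewrite -mconj_comp (tw_UU t H) mconj1.
- by move=> H; rewrite -mconj_comp (tw_VV t H) mconj1.
- by rewrite -mconj_comp (tw_UV t) mconj0.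
- by rewrite -mconj_comp (tw_VU t) mconj0.
- by move=> H; rewrite (tw_U0 t H) mconj0.
- by move=> H; rewrite (tw_V0 t H) mconj0.
- by move=> H; rewrite (tw_U0p t H) mconj0.
- by move=> H; rewrite (tw_V0p t H) mconj0.
Defined.

Definition map_cocone_twisted
    (b : forall j : 'I_n, biproduct (X (Mid j)) (Y (prevp (Mid j)))) :
  twisted (fun p => p != Tgt) (fun p => p != Src)
    (fun p q => dif (map_cpx F X) p q) (fun p q => diag g p (prevp q))
    (fun p q => - dif (map_cpx F Y) (prevp p) (prevp q))
    (map_cpx F (cocone f b)).
Proof.
pose t := cocone_twisted f b; set Q := cocone f b in t *.
apply: (@Twisted _ _ _ _ _ _ _ _ _ _ _ (map_cpx F Q)
  (fun p => @mconj _ _ _ _ X Q p p (twiU t p))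
  (fun p => @mconj _ _ _ _ Q X p p (twpU t p))
  (fun p => @mconj _ _ _ _ Y Q (prevp p) p (twiV t p))
  (fun p => @mconj _ _ _ _ Q Y p (prevp p) (twpV t p))) => p.
- by rewrite -!mconj_comp -mconjD tw_sum mconj1.
- move=> q; rewrite !mapE diag_map -mconjN -!mconj_comp -!mconjD.
  by rewrite (tw_dif t).
- by move=> H; rewrite -mconj_comp (tw_UU t H) mconj1.
- by move=> H; rewrite -mconj_comp (tw_VV t H) mconj1.
- by rewrite -mconj_comp (tw_UV t) mconj0.
- by rewrite -mconj_comp (tw_VU t) mconj0.
- by move=> H; rewrite (tw_U0 t H) mconj0.
- by move=> H; rewrite (tw_V0 t H) mconj0.
- by move=> H; rewrite (tw_U0p t H) mconj0.
- by move=> H; rewrite (tw_V0p t H) mconj0.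
Defined.
End MapTwisted.
End MapFold.

(** * Complexes in a full subcategory *)

Section FullSub.
Context {n : nat} {C : preadd} (S : set C).
Local Notation F := (incl S).

Section Down.
Context {A K A' K' : full_sub S} (X : cpx n A K) (Y : cpx n A' K').

Definition down p q (u : hom (map_cpx F X p) (map_cpx F Y q)) : hom (X p) (Y q) :=
  munfold F Y q \oC u \oC mfold F X p.

(** The inclusion of a full subcategory is bijective on such morphisms, so
    chain maps and homotopies between image complexes come from the
    subcategory. *)
Lemma downK p q (u : hom (map_cpx F X p) (map_cpx F Y q)) : mconj F (down u) = u.
Proof.
change (mfold F Y q \oC (munfold F Y q \oC u \oC mfold F X p) \oC munfold F X p = u).
by rewrite !compA munfoldK comp1m -compA munfoldK compm1.
Qed.

Lemma mconj_inj p q : injective (@mconj n _ _ F _ _ _ _ X Y p q).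
Proof.
apply: (can_inj (g := @down p q)) => u.
change (munfold F Y q \oC (mfold F Y q \oC fhom F u \oC munfold F X p)
  \oC mfold F X p = fhom F u).
by rewrite !compA mfoldK comp1m -compA mfoldK compm1.
Qed.
End Down.

Lemma down_chmap (A K A' K' : full_sub S) (X : cpx n A K) (Y : cpx n A' K')
    (g : chmap (map_cpx F X) (map_cpx F Y)) :
  exists f : chmap X Y, forall p, g p = mconj F (f p).
Proof.
have H p q : down (g q) \oC dif X p q = dif Y p q \oC down (g p).
  by apply: (@mconj_inj _ _ _ _ X Y); rewrite !mconj_comp !downK -!mapE cm_comm.
by exists (Chmap H) => p; rewrite /= downK.
Qed.

Lemma down_ends (A K : full_sub S) (X Y : cpx n A K)
    (g : chmap (map_cpx F X) (map_cpx F Y)) (f : chmap X Y) :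
  (forall p, g p = mconj F (f p)) -> fix_ends g -> fix_ends f.
Proof.
move=> gE [g0 g1]; split; apply: (@mconj_inj _ _ _ _ X Y).
  rewrite -gE g0 /mconj /=; symmetry; rewrite comp1m; exact: comp1m.
rewrite -gE g1 /mconj /=; symmetry; rewrite comp1m; exact: comp1m.
Qed.

Lemma reflect_homotopic (A K A' K' : full_sub S) (X : cpx n A K) (Y : cpx n A' K')
    (u v : forall p, hom (X p) (Y p)) :
  homotopic (fun p => mconj F (u p)) (fun p => mconj F (v p)) -> homotopic u v.
Proof.
case=> h Hh; exists (fun p q => down (h p q)) => p.
apply: (@mconj_inj _ _ _ _ X Y).
by rewrite !mconjD mconjN !mconj_comp !downK -!mapE Hh.
Qed.

Lemma reflect_htpy (A K : full_sub S) (X Y : cpx n A K) :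
  htpy_equiv (map_cpx F X) (map_cpx F Y) -> htpy_equiv X Y.
Proof.
case=> f [g [fe ge [h Hh] [k Hk]]].
have [f' Hf] := down_chmap f; have [g' Hg] := down_chmap g.
exists f', g'; split; [exact: down_ends Hf fe|exact: down_ends Hg ge| |].
- apply: reflect_homotopic; exists h => p.
  by rewrite -Hh mconj_comp mconj1 -Hf -Hg.
- apply: reflect_homotopic; exists k => p.
  by rewrite -Hk mconj_comp mconj1 -Hf -Hg.
Qed.

Section SubCpx.
Context {A K : full_sub S} (X : cpx n (sval A) (sval K)).
Hypothesis SX : forall j, S (mid X j).

Let m (j : 'I_n) : full_sub S := exist S (mid X j) (SX j).
Definition sub_to p : @hom C (X p) (sval (with_ends A m K p)) :=
  match p with Src => idm _ | Mid j => idm _ | Tgt => idm _ end.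
Definition sub_from p : @hom C (sval (with_ends A m K p)) (X p) :=
  match p with Src => idm _ | Mid j => idm _ | Tgt => idm _ end.

Lemma sub_toK p : sub_from p \oC sub_to p = idm (X p).
Proof. by case: p => [|j|]; apply: comp1m. Qed.
Lemma sub_fromK p : sub_to p \oC sub_from p = idm (sval (with_ends A m K p)).
Proof. by case: p => [|j|]; apply: comp1m. Qed.

Let d p q : @hom (full_sub S) (with_ends A m K p) (with_ends A m K q) :=
  sub_to q \oC dif X p q \oC sub_from p.

Lemma sub_shape p q : deg q != (deg p).+1 -> d p q = 0.
Proof. by move=> pq; rewrite /d dif_shape // compm0 comp0m. Qed.

Lemma sub_difK p q r : d q r \oC d p q = 0.
Proof.
rewrite /d /= !compA -(compA _ (sub_from q)) sub_toK compm1.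
by rewrite -(compA _ (dif X q r)) difK compm0 comp0m.
Qed.

Definition sub_cpx : cpx n A K := Cpx sub_shape sub_difK.

Lemma sub_cpx_htpy : htpy_equiv X (map_cpx F sub_cpx).
Proof.
pose u (p : pos n) : hom (X p) (map_cpx F sub_cpx p) :=
  match p with Src => idm _ | Mid j => idm _ | Tgt => idm _ end.
pose v (p : pos n) : hom (map_cpx F sub_cpx p) (X p) :=
  match p with Src => idm _ | Mid j => idm _ | Tgt => idm _ end.
have E p q : dif (map_cpx F sub_cpx) p q = u q \oC dif X p q \oC v p.
  by case: p => [|i|]; case: q => [|j|].
have uv p : u p \oC v p = idm (map_cpx F sub_cpx p).
  by case: p => [|j|]; apply: comp1m.
have vu p : v p \oC u p = idm (X p).
  by case: p => [|j|]; apply: comp1m.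
have uC p q : u q \oC dif X p q = dif (map_cpx F sub_cpx) p q \oC u p.
  by rewrite E -!compA vu compm1.
by apply: iso_htpy vu uv uC.
Qed.
End SubCpx.
End FullSub.

(** * The induced n-exangulated structure *)

Section Subcategory.
Context {n : nat} {C : preadd} {E : biadd C} {s : realization n E} {S : set C}.
Hypothesis nodd : odd n.
Hypothesis Hs : nexangulated s.
Hypothesis Sd : dense S.
Hypothesis Sc : complete s S.

Let n0 : (0 < n)%N := nex_gt0 Hs.
Let rs : exact_realization s := nex_real Hs.
Local Notation F := (incl S).

Lemma dense_complete_extension_closed : extension_closed s S.
Proof.
split; first exact: (sub_additive nodd Hs Sd Sc).
  exact: (sub_iso_closed nodd Hs Sd Sc).
by move=> A K x; apply: (sub_extension nodd Hs Sd Sc).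
Qed.

Lemma induced_ex (A K : full_sub S) (x : restr S E K A) :
  exists X : cpx n A K, s (x : E (sval K) (sval A)) = hclass (map_cpx F X).
Proof.
have [X [sX SX]] := sub_extension nodd Hs Sd Sc (x : E (sval K) (sval A))
  (svalP A) (svalP K).
by exists (sub_cpx SX); apply: (real_htpy sX); apply: sub_cpx_htpy.
Qed.

Lemma induced_realization_ex : exists t : realization n (restr S E),
  induced_realization s t.
Proof.
exists (fun K A x => hclass (sval (cid (induced_ex x)))) => A K x.
exists (sval (cid (induced_ex x))); split=> //.
exact: (svalP (cid (induced_ex x))).
Qed.

Context {t : realization n (restr S E)}.
Hypothesis Ht : induced_realization s t.

(** This reduces statements on [t] to statements on [s].  It holds since the
    inclusion of a full subcategory preserves and reflects homotopy
    equivalences. *)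
Lemma induced_iff (A K : full_sub S) (x : restr S E K A) (X : cpx n A K) :
  t x = hclass X <-> s (x : E (sval K) (sval A)) = hclass (map_cpx F X).
Proof.
have [X' [sX' tX']] := Ht x; rewrite sX' tX'.
by split=> /hclass_eq H; apply/hclass_eq; [exact: (map_htpy F H)|exact: reflect_htpy H].
Qed.

Lemma is_zero_incl (Z : full_sub S) : is_zero Z -> is_zero (sval Z).
Proof. by move=> /is_zeroP e; apply/is_zeroP. Qed.

(** The two complexes have the same terms up to moving the inclusion across the
    case distinction on the degree. *)
Lemma map_triv_src (A Z : full_sub S) :
  htpy_equiv (triv_src n (sval A) (sval Z)) (map_cpx F (triv_src n A Z)).
Proof.
pose u (p : pos n) : hom (triv_src n (sval A) (sval Z) p)
    (map_cpx F (triv_src n A Z) p) :=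
  match p with
  | Src => idm _
  | Mid j => if nat_of_ord j == 0%N as b
      return @hom C (if b then sval A else sval Z) (sval (if b then A else Z))
      then idm _ else idm _
  | Tgt => idm _ end.
pose v (p : pos n) : hom (map_cpx F (triv_src n A Z) p)
    (triv_src n (sval A) (sval Z) p) :=
  match p with
  | Src => idm _
  | Mid j => if nat_of_ord j == 0%N as b
      return @hom C (sval (if b then A else Z)) (if b then sval A else sval Z)
      then idm _ else idm _
  | Tgt => idm _ end.
have uv p : u p \oC v p = idm (map_cpx F (triv_src n A Z) p).
  case: p => [|j|]; rewrite /u /v /=; try exact: comp1m.
  by rewrite /map_mid /= /triv_src_mid; case: (_ == _); exact: comp1m.
have vu p : v p \oC u p = idm (triv_src n (sval A) (sval Z) p).
  case: p => [|j|]; rewrite /u /v /=; try exact: comp1m.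
  by rewrite /triv_src_mid; case: (_ == _); exact: comp1m.
have E' p q : u q \oC dif (triv_src n (sval A) (sval Z)) p q
    = dif (map_cpx F (triv_src n A Z)) p q \oC u p.
  case: p => [|i|]; case: q => [|j|] /=; try by rewrite comp0m compm0.
  rewrite compm1 /map_mid /= /triv_src_mid.
  by case: (_ == _) => /=; rewrite comp1m.
by apply: (iso_htpy _ _ vu uv E').
Qed.

Lemma map_triv_tgt (A Z : full_sub S) :
  htpy_equiv (triv_tgt n (sval Z) (sval A)) (map_cpx F (triv_tgt n Z A)).
Proof.
pose u (p : pos n) : hom (triv_tgt n (sval Z) (sval A) p)
    (map_cpx F (triv_tgt n Z A) p) :=
  match p with
  | Src => idm _
  | Mid j => if j.+1 == n as b
      return @hom C (if b then sval A else sval Z) (sval (if b then A else Z))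
      then idm _ else idm _
  | Tgt => idm _ end.
pose v (p : pos n) : hom (map_cpx F (triv_tgt n Z A) p)
    (triv_tgt n (sval Z) (sval A) p) :=
  match p with
  | Src => idm _
  | Mid j => if j.+1 == n as b
      return @hom C (sval (if b then A else Z)) (if b then sval A else sval Z)
      then idm _ else idm _
  | Tgt => idm _ end.
have uv p : u p \oC v p = idm (map_cpx F (triv_tgt n Z A) p).
  case: p => [|j|]; rewrite /u /v /=; try exact: comp1m.
  by rewrite /map_mid /= /triv_tgt_mid; case: (_ == _); exact: comp1m.
have vu p : v p \oC u p = idm (triv_tgt n (sval Z) (sval A) p).
  case: p => [|j|]; rewrite /u /v /=; try exact: comp1m.
  by rewrite /triv_tgt_mid; case: (_ == _); exact: comp1m.
have E' p q : u q \oC dif (triv_tgt n (sval Z) (sval A)) p q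
    = dif (map_cpx F (triv_tgt n Z A)) p q \oC u p.
  case: p => [|i|]; case: q => [|j|] /=; try by rewrite comp0m compm0.
  rewrite comp1m /map_mid /= /triv_tgt_mid.
  by case: (_ == _) => /=; rewrite compm1.
by apply: (iso_htpy _ _ vu uv E').
Qed.

Lemma sub_exangle (A K : full_sub S) (x : restr S E K A) (X : cpx n A K) :
  is_exangle (map_cpx F X) (x : E (sval K) (sval A)) -> is_exangle X x.
Proof.
move=> ex W; have [H1 H2 H3 H4] := ex (sval W); split.
- move=> j; move: (H1 j); move: (prevp (Mid j)) (nextp (Mid j)) => p q.
  by case: p => [|i|]; case: q => [|k|].
- by move: H2; case: (at_ n n).
- move=> j; move: (H3 j); move: (prevp (Mid j)) (nextp (Mid j)) => p q.
  by case: p => [|i|]; case: q => [|k|].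
- by move: H4; case: (at_ n 1).
Qed.

Lemma induced_exact : exact_realization t.
Proof.
split.
- by move=> A K x; have [X [_ tX]] := Ht x; exists X.
- move=> A K B D x y X Y a c /induced_iff sX /induced_iff sY e.
  have [f [f0 f1]] := real_lift rs (a := a : hom (sval A) (sval B))
    (c := c : hom (sval K) (sval D)) sX sY e.
  have [g Hg] := down_chmap f; exists g; split.
    by rewrite -f0 Hg /mconj /= comp1m compm1.
  by rewrite -f1 Hg /mconj /= comp1m compm1.
- move=> A K x X /induced_iff sX; apply: sub_exangle.
  exact: (real_exangle rs sX).
- move=> A Z /is_zero_incl zZ; have [H1 H2] := real_triv rs (sval A) zZ.
  split; apply/induced_iff; first exact: real_htpy H1 (map_triv_src A Z).
  exact: real_htpy H2 (map_triv_tgt A Z).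
Qed.

Lemma incl_inflation (A B : full_sub S) (u : hom A B) :
  inflation t u -> inflation s (u : hom (sval A) (sval B)).
Proof.
case=> {B u} {}A K X [x /induced_iff sX].
have e : munfold F X (at_ n 1) \oC dif (map_cpx F X) Src (at_ n 1)
    \oC idm (sval A) = fhom F (dif X Src (at_ n 1)).
  rewrite mapE /mconj !compA mfoldK comp1m compm1; exact: compm1.
change (inflation s (fhom F (dif X Src (at_ n 1)))); rewrite -e.
exact: (inflation_iso rs (iso_refl (sval A))
  (IsoFrom (munfoldK F X (at_ n 1)) (mfoldK F X (at_ n 1))) (ex_intro _ _ sX)).
Qed.

Lemma incl_deflation (A B : full_sub S) (u : hom A B) :
  deflation t u -> deflation s (u : hom (sval A) (sval B)).
Proof.
case=> {u} {}A {}B X [x /induced_iff sX].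
have e : idm (sval B) \oC dif (map_cpx F X) (at_ n n) Tgt
    \oC mfold F X (at_ n n) = fhom F (dif X (at_ n n) Tgt).
  rewrite mapE /mconj -!compA mfoldK compm1 comp1m; exact: comp1m.
change (deflation s (fhom F (dif X (at_ n n) Tgt))); rewrite -e.
exact: (deflation_iso rs (iso_refl (sval B))
  (IsoFrom (munfoldK F X (at_ n n)) (mfoldK F X (at_ n n))) (ex_intro _ _ sX)).
Qed.

(** An ambient conflation starting with [u] may have terms outside [S] in degrees
    at least 2; padding moves them into [S], at the price of an isomorphic
    first differential, and [inflation_iso] restores [u] itself. *)
Lemma reflect_inflation (A0 B0 : C) (u : hom A0 B0) :
  inflation s u -> forall (SA : S A0) (SB : S B0),
  @inflation n (full_sub S) (restr S E) t (exist S A0 SA) (exist S B0 SB) u.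
Proof.
case=> {A0 B0 u} A K X cX SA SB.
have [A' [K' [X' [i [r [SX' [x sX'] ri ir]]]]]] :=
  pad_inflation nodd Hs Sd Sc cX SA SB.
pose A1 : full_sub S := exist S A' (SX' Src).
pose K1 : full_sub S := exist S K' (SX' Tgt).
pose SM j : S (mid X' j) := SX' (Mid j).
pose X1 : cpx n A1 K1 := @sub_cpx n C S A1 K1 X' SM.
have cX1 : conflation t X1.
  exists x; apply/induced_iff; apply: real_htpy sX' _.
  exact: (@sub_cpx_htpy n C S A1 K1 X' SM).
pose q := at_ n 1.
have q1 : (deg q <= 1)%N by rewrite deg_at.
pose fb : @hom C (sval (X1 q)) (X q) := r q \oC @sub_from n C S A1 K1 X' SM q.
pose bb : @hom C (X q) (sval (X1 q)) := @sub_to n C S A1 K1 X' SM q \oC i q.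
have bfb : bb \oC fb = idm (sval (X1 q)).
  rewrite /bb /fb !compA -(compA _ (i q)) (ir q q1) compm1.
  exact: (@sub_fromK n C S A1 K1 X' SM).
have fbb : fb \oC bb = idm (X q).
  by rewrite /bb /fb !compA -(compA (r q)) sub_toK compm1 ri.
pose a : @iso_from (full_sub S) A1 := @IsoFrom (full_sub S) A1 (exist S A SA)
  (r Src) (i Src) (ir Src isT) (ri Src).
pose b : @iso_from (full_sub S) (X1 q) := @IsoFrom (full_sub S) (X1 q)
  (exist S (X q) SB) fb bb bfb fbb.
have rdi : r q \oC dif X' Src q \oC i Src = dif X Src q.
  by rewrite cm_comm -compA ri compm1.
have := inflation_iso induced_exact a b cX1.
suff -> : fwd b \oC dif X1 Src q \oC bwd a = dif X Src q by [].
change (r q \oC @sub_from n C S A1 K1 X' SM q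
  \oC (@sub_to n C S A1 K1 X' SM q \oC dif X' Src q \oC idm A') \oC i Src
  = dif X Src q).
rewrite compm1 !compA -(compA (r q)) sub_toK compm1.
exact: rdi.
Qed.

Lemma reflect_deflation (A0 B0 : C) (u : hom A0 B0) :
  deflation s u -> forall (SA : S A0) (SB : S B0),
  @deflation n (full_sub S) (restr S E) t (exist S A0 SA) (exist S B0 SB) u.
Proof.
case=> {A0 B0 u} A K X cX SB SK.
have [A' [K' [X' [i [r [SX' [x sX'] ri ir]]]]]] :=
  pad_deflation nodd Hs Sd Sc cX SK SB.
pose A1 : full_sub S := exist S A' (SX' Src).
pose K1 : full_sub S := exist S K' (SX' Tgt).
pose SM j : S (mid X' j) := SX' (Mid j).
pose X1 : cpx n A1 K1 := @sub_cpx n C S A1 K1 X' SM.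
have cX1 : conflation t X1.
  exists x; apply/induced_iff; apply: real_htpy sX' _.
  exact: (@sub_cpx_htpy n C S A1 K1 X' SM).
pose q := at_ n n.
have q1 : (n <= deg q)%N by rewrite deg_at.
pose fb : @hom C (sval (X1 q)) (X q) := r q \oC @sub_from n C S A1 K1 X' SM q.
pose bb : @hom C (X q) (sval (X1 q)) := @sub_to n C S A1 K1 X' SM q \oC i q.
have bfb : bb \oC fb = idm (sval (X1 q)).
  rewrite /bb /fb !compA -(compA _ (i q)) (ir q q1) compm1.
  exact: (@sub_fromK n C S A1 K1 X' SM).
have fbb : fb \oC bb = idm (X q).
  by rewrite /bb /fb !compA -(compA (r q)) sub_toK compm1 ri.
pose a : @iso_from (full_sub S) K1 := @IsoFrom (full_sub S) K1 (exist S K SK)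
  (r Tgt) (i Tgt) (ir Tgt (leqnSn n)) (ri Tgt).
pose b : @iso_from (full_sub S) (X1 q) := @IsoFrom (full_sub S) (X1 q)
  (exist S (X q) SB) fb bb bfb fbb.
have rdi : r Tgt \oC dif X' q Tgt \oC i q = dif X q Tgt.
  by rewrite cm_comm -compA ri compm1.
have := deflation_iso induced_exact a b cX1.
suff -> : fwd a \oC dif X1 q Tgt \oC bwd b = dif X q Tgt by [].
change (r Tgt \oC (idm K' \oC dif X' q Tgt \oC @sub_from n C S A1 K1 X' SM q)
  \oC (@sub_to n C S A1 K1 X' SM q \oC i q) = dif X q Tgt).
rewrite comp1m !compA -(compA _ (sub_from _ q)) sub_toK compm1.
exact: rdi.
Qed.

Lemma sub_biproducts (U V : 'I_n -> full_sub S) :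
  exists b : forall j, biproduct (U j) (V j), True.
Proof.
have [_ bip] := sub_additive nodd Hs Sd Sc.
have H j : exists b : biproduct (U j) (V j), True.
  by have [b] := bip (U j) (V j); exists b.
by exists (fun j => sval (cid (H j))).
Qed.

(** For (EA2) and its dual the lift provided by the ambient category is a
    morphism of the subcategory by fullness.  Its cone is formed with ambient
    biproducts, which may lie outside [S]; it is replaced by the isomorphic
    cone formed with biproducts of the subcategory. *)
Lemma sub_nexangulated : nexangulated t.
Proof.
split=> //.
- exact: (sub_additive nodd Hs Sd Sc).
- exact: induced_exact.
- move=> [A SA] [B SB] [D SD] u v /incl_inflation Hu /incl_inflation Hv.
  exact: reflect_inflation (nex_EA1 Hs Hu Hv) _ _.
- move=> [A SA] [B SB] [D SD] u v /incl_deflation Hu /incl_deflation Hv.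
  exact: reflect_deflation (nex_EA1op Hs Hu Hv) _ _.
- move=> A K D x c X Y /induced_iff sX /induced_iff sY.
  have [f [f0 f1 [b sQ]]] := nex_EA2 Hs sX sY.
  have [f' Hf] := down_chmap f; exists f'; split.
  + by rewrite -[idm A]f0 Hf /mconj /= comp1m compm1.
  + by rewrite -[c]f1 Hf /mconj /= comp1m compm1.
  have [b' _] := sub_biproducts (fun j => X (nextp (Mid j))) (fun j => Y (Mid j)).
  exists b'; apply/induced_iff.
  (* The isomorphism of the two cones is an identity on the end terms, up to the
     identification of the image of the term of degree 1. *)
  set tS := tw_map (cone_twisted f b) (map_cone_twisted Hf b') Src.
  set tT := tw_map (map_cone_twisted Hf b') (cone_twisted f b) Tgt.
  have eS : tS = munfold F X (at_ n 1).
    rewrite /tS /= compm1 compm0 addr0.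
    exact: etrans (congr1 (fun z => z \oC munfold F X (at_ n 1))
      (comp1m (idm (sval (X (at_ n 1)))))) (comp1m _).
  have eT : tT = idm (sval D).
    rewrite /tT /= comp0m comp1m add0r /mconj /= comp1m; exact: comp1m.
  rewrite -(tw_real (cone_twisted f b) (map_cone_twisted Hf b') rs sQ).
  rewrite -/tS -/tT eS eT pull_id.
  congr (s _); rewrite -push_comp mapE /mconj !compA mfoldK comp1m.
  by rewrite compm1.
- move=> A B K x a X Y /induced_iff sX /induced_iff sY.
  have [f [f0 f1 [b sQ]]] := nex_EA2op Hs sX sY.
  have [f' Hf] := down_chmap f; exists f'; split.
  + by rewrite -[a]f0 Hf /mconj /= comp1m compm1.
  + by rewrite -[idm K]f1 Hf /mconj /= comp1m compm1.
  have [b' _] := sub_biproducts (fun j => X (Mid j)) (fun j => Y (prevp (Mid j))).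
  exists b'; apply/induced_iff.
  set tS := tw_map (cocone_twisted f b) (map_cocone_twisted Hf b') Src.
  set tT := tw_map (map_cocone_twisted Hf b') (cocone_twisted f b) Tgt.
  have eS : tS = idm (sval A).
    rewrite /tS /= compm0 compm1 addr0 /mconj /= comp1m; exact: comp1m.
  have eT : tT = mfold F Y (at_ n n).
    rewrite /tT /= comp0m comp1m add0r.
    exact: etrans (compm1 _) (compm1 (mfold F Y (at_ n n))).
  rewrite -(tw_real (cocone_twisted f b) (map_cocone_twisted Hf b') rs sQ).
  rewrite -/tS -/tT eS eT push_id.
  congr (s _); rewrite -pull_comp mapE /mconj -!compA mfoldK compm1.
  by rewrite comp1m.
Qed.

Lemma induced_subcategory : nexangulated_subcategory s t.
Proof.
split; [exact: (sub_iso_closed nodd Hs Sd Sc)|exact: sub_nexangulated|].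
exists (fun K A x => x); split; last by move=> K A x y.
by split; [split|move=> A K x X /induced_iff].
Qed.

End Subcategory.

Unset Implicit Arguments.

Theorem proposition3p9 (n : nat) (C : preadd) (E : biadd C)
    (s : realization n E) (S : set C) :
  odd n -> nexangulated s -> dense S -> complete s S ->
  extension_closed s S /\
  (exists t : realization n (restr S E), induced_realization s t) /\
  (forall t : realization n (restr S E),
     induced_realization s t -> nexangulated_subcategory s t).
Proof.
move=> nodd Hs Sd Sc; split; first exact: dense_complete_extension_closed.
split; first exact: induced_realization_ex.
by move=> t; apply: induced_subcategory.
Qed.
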